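(* For real $x$, $\nu$, and positive $a$, $$(2a)^{\nu/2}\, c^{a}_{\lceil a-x\sqrt{2a}\rceil}(\nu) = H_\nu(x) + O\left(\frac{1}{\sqrt a}\right) \qquad (a\to\infty),$$ where $c_n^a(\nu)$ are the Charlier polynomials and $H_\nu(x)$ is the Hermite function. The error bound $O(1/\sqrt a)$ is uniform for $\nu$ and $x$ in any bounded interval, i.e. for all bounded real intervals $I,J$ there are constants $C,a_0>0$ such that the absolute value of the error is at most $C/\sqrt a$ for all $a\ge a_0$, $\nu\in I$, $x\in J$. The bound is sharp in the sense that there are $\nu$ and $x$ such that the error is proportional to $1/\sqrt a$ for arbitrarily large $a$, i.e. there are real $\nu,x$, a constant $K\neq 0$, and arbitrarily large $a$ for which $(2a)^{\nu/2} c^{a}_{\lceil a-x\sqrt{2a}\rceil}(\nu)-H_\nu(x)=K/\sqrt a$.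
   Context: For $a>0$ and integer $n\ge 0$, the Charlier polynomial is $c_n^a(x):=\sum_{k=0}^{n}\binom{n}{k}\binom{x}{k}k!\,(-a)^{-k}$, where $\binom{x}{k}:=x(x-1)\cdots(x-k+1)/k!$ for $k\ge1$ and $\binom{x}{0}:=1$ (real $x$). $\lceil x\rceil$ is the smallest integer not smaller than $x$; $a$ is taken large enough that $\lceil a-x\sqrt{2a}\rceil\ge 0$. For real $\nu,x$ the Hermite function is $$H_\nu(x):=2^\nu\sqrt\pi\left[\frac{1}{\Gamma\left(\frac{1-\nu}{2}\right)}M\left(-\frac{\nu}{2};\frac12;x^2\right)-\frac{2x}{\Gamma\left(-\frac{\nu}{2}\right)}M\left(\frac{1-\nu}{2};\frac32;x^2\right)\right],$$ where $M$ is the confluent hypergeometric function of the first kind and $1/\Gamma$ is interpreted as $0$ at non-positive integers. *)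

(* Defs.v *)
From HB Require Import structures.
From mathcomp Require Import all_boot all_order all_algebra.
From mathcomp Require Import all_classical all_reals all_analysis.

Set Implicit Arguments.
Unset Strict Implicit.
Unset Printing Implicit Defensive.

Import Order.TTheory GRing.Theory Num.Theory.
Import numFieldNormedType.Exports.

Local Open Scope classical_set_scope.
Local Open Scope ring_scope.

Definition gbinom {R : realType} (x : R) (k : nat) : R :=
  (\prod_(i < k) (x - i%:R)) / k`!%:R.

Definition charlier {R : realType} (a : R) (n : nat) (x : R) : R :=
  \sum_(k < n.+1) 'C(n, k)%:R * gbinom x k * k`!%:R * (- a) ^- k.

(* This is the Gamma function only for 0 < z. *)
Definition euler_integral {R : realType} (z : R) : R :=
  \int[lebesgue_measure]_(t in `]0, +oo[) (t `^ (z - 1) * expR (- t)).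

(* Extension to the real line by Gamma(z) = Gamma(z + n) / (z (z+1) ... (z+n-1)),
   where n is the least natural number with 0 < z + n (so n = 0 if 0 < z).
   The denominator vanishes exactly when z is a non-positive integer. Division
   being total (x / 0 = 0), Gamma z is then 0, and so is (Gamma z)^-1, in
   agreement with the convention 1 / Gamma = 0 at the poles. *)
Definition Gamma {R : realType} (z : R) : R :=
  let n := Num.truncn (1 - z) in
  euler_integral (z + n%:R) / \prod_(i < n) (z + i%:R).

Definition rising {R : realType} (b : R) (k : nat) : R :=
  \prod_(i < k) (b + i%:R).

(* Kummer's function M(b; c; z), for c not a non-positive integer. *)
Definition kummerM {R : realType} (b c z : R) : R :=
  limn (series (fun k : nat => rising b k / rising c k * z ^+ k / k`!%:R)).

Definition hermite {R : realType} (nu x : R) : R :=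
  2 `^ nu * Num.sqrt pi *
    ((Gamma ((1 - nu) / 2))^-1 * kummerM (- nu / 2) (1 / 2) (x ^+ 2)
     - 2 * x / Gamma (- nu / 2) * kummerM ((1 - nu) / 2) (3 / 2) (x ^+ 2)).

Definition charlier_index {R : realType} (a x : R) : int :=
  Num.ceil (a - x * Num.sqrt (2 * a)).

(* Only meaningful when 0 <= charlier_index a x. *)
Definition scaled_charlier {R : realType} (a nu x : R) : R :=
  (2 * a) `^ (nu / 2) * charlier a `|charlier_index a x|%N nu.

(* Lets the Landau notations be used at +oo. *)
Canonical pinfty_filter_on (R : realType) :=
  FilterType (pinfty_nbhs R) (@proper_pinfty_nbhs R).

(* Main.v *)
Require Import Defs.
From HB Require Import structures.
From mathcomp Require Import all_boot all_order all_algebra.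
From mathcomp Require Import all_classical all_reals all_analysis.
From mathcomp Require Import measurable_realfun.
From mathcomp Require Import ring lra.
Import Order.TTheory GRing.Theory Num.Theory.
Import numFieldNormedType.Exports.
Local Open Scope classical_set_scope.
Local Open Scope ring_scope.

Set Implicit Arguments.
Unset Strict Implicit.
Unset Printing Implicit Defensive.

(* For [nu < 0], put [q = - nu] and [c = sqrt (2 a)]. Writing the rising
   factorials of [q] as moments of the Gamma density turns the Charlier sum
   into an integral, and after the substitution [t = c s],
     [(2a)^(nu/2) c_n^a(nu)
        = 1/Gamma(q) int_0^oo s^(q-1) e^(-c s) (1 + 2 s/c)^n ds],
   while termwise integration and the duplication formula give
     [H_nu(x) = 1/Gamma(q) int_0^oo s^(q-1) e^(-s^2 - 2 x s) ds].
   For [n = a - x c + O(1)] the logarithms of the two kernels differ by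
   [O((1 + s)^3 / c)], and both kernels are [O(e^(-s))] once [c] is large; this
   is the estimate for [nu <= -1]. Both sides satisfy a three-term recurrence in
   [nu], the one for the Charlier side having coefficients that differ by
   [O(1/c)] from those for the Hermite function, so the estimate propagates to
   [nu <= m] by induction on [m].
   For [nu = 1], [x = 0] and [a = m + 1/2] the error is exactly
   [- sqrt 2 / 2 / sqrt a]. *)

(** * Charlier polynomials and Kummer series *)

(** The integral formulas hold for all q > 0, yet the estimate starts at q >= 1: there s^(q-1) has
    no singularity at 0 and 1/Gamma(q) <= q, so one constant serves a whole range of q. The
    recurrence climbs from the values at nu - 2 and nu - 1 to the one at nu, so that range suffices
    to reach every bounded set of nu.

    The induction carries a bound on the scaled Charlier values beside the error bound, because the
    O(1/c) discrepancy between the coefficients is multiplied by such a value.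

    The delicate point of the comparison is a majorant independent of n: the exponent n ln(1 + 2s/c)
    - c s is close to -s^2 - 2xs only while s is small against c, and decays merely linearly beyond.
    Hence the majorant e^(-s) in place of a Gaussian.

    The duplication formula is obtained in the spirit of Bohr and Mollerup, from positivity, the
    functional equation and one inequality for shifts by at most 1. *)

Definition falling {R : realType} (x : R) (k : nat) : R :=
  \prod_(i < k) (x - i%:R).

Section Polynomials.
Context {R : realType}.
Implicit Types (a b c x z : R) (n k : nat).

Lemma fallingSr x k : falling x k.+1 = falling x k * (x - k%:R).
Proof. by rewrite /falling big_ord_recr. Qed.

Lemma fallingSl x k : falling x k.+1 = x * falling (x - 1) k.
Proof.
rewrite /falling big_ord_recl/= subr0; congr (_ * _).
by apply: eq_bigr => i _; rewrite /bump/= natrD opprD addrA.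
Qed.

Lemma falling_diff x k :
  falling (x + 1) k.+1 - falling x k.+1 = k.+1%:R * falling x k.
Proof.
by rewrite fallingSl addrK fallingSr -natr1; ring.
Qed.

Lemma charlierE a n x :
  charlier a n x = \sum_(k < n.+1) 'C(n, k)%:R * (- a) ^- k * falling x k.
Proof.
apply: eq_bigr => k _; rewrite /gbinom -/(falling x k).
have k0 : k`!%:R != 0 :> R by rewrite pnatr_eq0 -lt0n fact_gt0.
by rewrite -(mulrA 'C(n, k)%:R) divfK// mulrAC.
Qed.

(** A difference equation in the argument, at fixed degree: in the falling-factorial basis the
    forward difference times a has coefficients [d k * (k - n)], the backward difference times x has
    [d k * k], and subtracting leaves -n times the polynomial. *)
Lemma charlier_rec a n x : a != 0 ->
  a * charlier a n (x + 1) =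
  (x + a - n%:R) * charlier a n x - x * charlier a n (x - 1).
Proof.
move=> a0; pose d k := 'C(n, k)%:R * (- a) ^- k.
have lhs : a * (charlier a n (x + 1) - charlier a n x) =
    \sum_(k < n.+1) d k * (k%:R - n%:R) * falling x k.
  rewrite !charlierE -sumrB big_ord_recl/= /falling !big_ord0 subrr add0r.
  rewrite mulr_sumr [RHS]big_ord_recr/= subrr mulr0 mul0r addr0.
  apply: eq_bigr => k _.
  rewrite /bump/= add1n -/(falling _ _) -/(falling _ _) -/(falling _ _).
  rewrite -mulrBr falling_diff mulrA mulrA; congr (_ * _); rewrite /d.
  have -> : a * ('C(n, k.+1)%:R * (- a) ^- k.+1) =
      - ('C(n, k.+1)%:R * (- a) ^- k).
    rewrite exprS invfM invrN; move: ((- a) ^- k) => P; by field.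
  rewrite mulNr mulrAC -natrM mulnC mul_bin_left natrM natrB; last first.
    by rewrite ltnW.
  ring.
(* The basis identity behind this is x (x-1)_k = (x - k) (x)_k for falling factorials, both sides
   being (x)_(k+1). *)
have rhs : x * charlier a n x - x * charlier a n (x - 1) =
    \sum_(k < n.+1) d k * k%:R * falling x k.
  rewrite !charlierE !mulr_sumr -sumrB; apply: eq_bigr => k _.
  have := fallingSl x k; rewrite fallingSr => h.
  rewrite (mulrCA x (_ * _) (falling (x - 1) k)) -h /d; ring.
have split_sum : \sum_(k < n.+1) d k * (k%:R - n%:R) * falling x k =
    \sum_(k < n.+1) d k * k%:R * falling x k - n%:R * charlier a n x.
  rewrite charlierE mulr_sumr -sumrB; apply: eq_bigr => k _; rewrite /d; ring.
rewrite split_sum -rhs in lhs.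
rewrite -[LHS](subrK (a * charlier a n x)) -mulrBr lhs; ring.
Qed.

Lemma risingSr b k : rising b k.+1 = rising b k * (b + k%:R).
Proof. by rewrite /rising big_ord_recr. Qed.

Lemma risingSl b k : rising b k.+1 = b * rising (b + 1) k.
Proof.
rewrite /rising big_ord_recl/= addr0; congr (_ * _).
by apply: eq_bigr => i _; rewrite /bump/= natrD addrA.
Qed.

Lemma rising_gt0 b k : 0 < b -> 0 < rising b k.
Proof. by move=> b0; apply: prodr_gt0 => i _; rewrite ltr_wpDr. Qed.

Lemma falling_opp x k : falling (- x) k = (-1) ^+ k * rising x k.
Proof.
rewrite /falling /rising -[k in (-1) ^+ k]card_ord -prodrN.
by apply: eq_bigr => i _; rewrite opprD.
Qed.

Definition kummer_term b c z (k : nat) : R :=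
  rising b k / rising c k * z ^+ k / k`!%:R.

(** Factor by factor, |b + i| <= (2|b| + 1)(c + i) once c >= 1/2, so an exponential series
    dominates. The two values of c that occur are 1/2 and 3/2. *)
Lemma kummer_term_le b c z k : 1 / 2 <= c ->
  `|kummer_term b c z k| <= exp_coeff ((2 * `|b| + 1) * `|z|) k.
Proof.
move=> c2; have c0 : 0 < c by lra.
rewrite /kummer_term /exp_coeff/= 3!normrM !normfV normrX.
rewrite (ger0_norm (ler0n _ _)) ler_wpM2r ?invr_ge0//.
rewrite exprMn ler_wpM2r ?exprn_ge0// (gtr0_norm (rising_gt0 k c0)).
rewrite ler_pdivrMr ?rising_gt0// /rising normr_prod.
rewrite -[k in _ ^+ k]card_ord -prodr_const -big_split/=.
apply: ler_prod => i _; rewrite normr_ge0/=.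
rewrite (le_trans (ler_normD _ _))// (ger0_norm (ler0n _ _)).
have i0 : 0 <= i%:R :> R by [].
have b0 := normr_ge0 b; nra.
Qed.

Lemma is_cvg_kummer b c z : 1 / 2 <= c -> cvgn (series (kummer_term b c z)).
Proof.
move=> c2; apply: normed_cvg.
apply: (series_le_cvg _ _ _
  (is_cvg_series_exp_coeff ((2 * `|b| + 1) * `|z|))) => // n.
- exact: normr_ge0.
- by rewrite exp_coeff_ge0// mulr_ge0// addr_ge0// mulr_ge0.
- exact: kummer_term_le.
Qed.

Lemma kummerM_cvg b c z : 1 / 2 <= c ->
  series (kummer_term b c z) @ \oo --> kummerM b c z.
Proof. exact: is_cvg_kummer. Qed.

Lemma eq_cvgn_unique (u v : R^nat) (l m : R) :
  u @ \oo --> l -> v @ \oo --> m -> u =1 v -> l = m.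
Proof.
move=> ul vm uv; apply: (@cvg_unique _ _ (u @ \oo)) => //.
by rewrite (funext uv).
Qed.

Lemma kummerM_cvgS b c z : 1 / 2 <= c ->
  series (fun k => kummer_term b c z k.+1) @ \oo --> kummerM b c z - 1.
Proof.
move=> c2; have -> : series (fun k => kummer_term b c z k.+1) =
    (fun n => series (kummer_term b c z) n.+1 - 1).
  apply/funext => n; rewrite /series/= big_nat_recl//.
  by rewrite /kummer_term/= /rising !big_ord0 expr0 divr1 mulr1 divr1 addrC addKr.
apply: cvgB; last exact: cvg_cst.
by rewrite (cvg_shiftS (series (kummer_term b c z))); exact: kummerM_cvg.
Qed.

(** The constant terms cancel; for the coefficient of z^(k+1), rising factorials satisfy (b)_(k+1) -
    (b-1)_(k+1) = (k+1) (b)_k and (c)_(k+1) = c (c+1)_k. *)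
Lemma kummerM_contig_z b c z : 1 / 2 <= c ->
  c * (kummerM b c z - kummerM (b - 1) c z) = z * kummerM b (c + 1) z.
Proof.
move=> c2; have c0 : 0 < c by lra.
have c1 : 1 / 2 <= c + 1 by lra.
pose l := kummerM b c z - 1 - (kummerM (b - 1) c z - 1).
have -> : kummerM b c z - kummerM (b - 1) c z = l by rewrite /l; ring.
apply: (@eq_cvgn_unique (fun n => c * (series (fun k => kummer_term b c z k.+1) n
      - series (fun k => kummer_term (b - 1) c z k.+1) n))
    (fun n => z * series (kummer_term b (c + 1) z) n)).
- by apply: cvgMl_tmp; apply: cvgB; exact: kummerM_cvgS.
- by apply: cvgMl_tmp; exact: kummerM_cvg.
move=> n.
rewrite /series/= -sumrB !mulr_sumr.
apply: eq_bigr => k _; rewrite /kummer_term.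
rewrite risingSr (risingSl (b - 1)) subrK (risingSl c) exprS factS natrM.
have k0 : k`!%:R != 0 :> R by rewrite pnatr_eq0 -lt0n fact_gt0.
have := @rising_gt0 (c + 1) k ltac:(lra) => r0.
rewrite -natr1; field.
by rewrite k0 natr1 pnatr_eq0/= !gt_eqF.
Qed.

(** Termwise, b (b+1)_k = (b)_k (b + k) collapses the left numerator to (b)_k (c + k), and c (c+1)_k
    = (c)_k (c + k) cancels the last factor. *)
Lemma kummerM_contig b c z : 1 / 2 <= c ->
  b * kummerM (b + 1) (c + 1) z + (c - b) * kummerM b (c + 1) z =
  c * kummerM b c z.
Proof.
move=> c2; have c0 : 0 < c by lra.
have c1 : 1 / 2 <= c + 1 by lra.
apply: (@eq_cvgn_unique
    (fun n => b * series (kummer_term (b + 1) (c + 1) z) n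
              + (c - b) * series (kummer_term b (c + 1) z) n)
    (fun n => c * series (kummer_term b c z) n)).
- by apply: cvgD; apply: cvgMl_tmp; exact: kummerM_cvg.
- by apply: cvgMl_tmp; exact: kummerM_cvg.
move=> n.
rewrite /series/= !mulr_sumr -big_split/=.
apply: eq_bigr => k _; rewrite /kummer_term.
have k0 : k`!%:R != 0 :> R by rewrite pnatr_eq0 -lt0n fact_gt0.
have r0 := @rising_gt0 (c + 1) k ltac:(lra).
have r1 := rising_gt0 k c0.
have e1 : b * rising (b + 1) k = rising b k * (b + k%:R).
  by rewrite -risingSl risingSr.
have e2 : c * rising (c + 1) k = rising c k * (c + k%:R).
  by rewrite -risingSl risingSr.
transitivity ((b * rising (b + 1) k + (c - b) * rising b k)
    / rising (c + 1) k * z ^+ k / k`!%:R); first by ring.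
rewrite e1.
have e3 : rising (c + 1) k = rising c k * (c + k%:R) / c.
  by rewrite -e2; field; rewrite gt_eqF.
have ck : c + k%:R != 0 by rewrite gt_eqF// ltr_wpDr.
by rewrite e3; field; rewrite ck k0 !gt_eqF.
Qed.

End Polynomials.

(** * Integrals over the positive half-line *)

Section PositiveHalfLine.
Context {R : realType}.
Notation mu := (@lebesgue_measure R).
Notation D := (`]0%R, +oo[%classic : set R).
Implicit Types (f g F G : R -> R) (A B : nat -> R) (a b : R).

(** Monotone convergence over compact intervals that avoid 0, where the integrand may be singular.
    The endpoints are arbitrary sequences so that images of intervals under a substitution are
    covered too. *)
Lemma integral_exhaustion A B f :
  nonincreasing_seq A -> nondecreasing_seq B -> (forall n, 0 < A n) ->
  A @ \oo --> (0 : R) -> B @ \oo --> +oo%R ->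
  measurable_fun D f -> (forall x : R, 0 < x -> 0 <= f x) ->
  (\int[mu]_(x in `[A n, B n]) (f x)%:E)%E @[n --> \oo] -->
  (\int[mu]_(x in D) (f x)%:E)%E.
Proof.
move=> dA iB A0 cA cB mf f0.
have AD n : `[A n, B n]%classic `<=` D.
  move=> x /=; rewrite !in_itv/= andbT => /andP[+ _].
  exact: lt_le_trans.
have -> : D = \bigcup_n `[A n, B n]%classic.
  apply/seteqP; split => x /=; last by case=> n _ /AD.
  rewrite in_itv/= andbT => x0.
  have [n [nA nB]] : exists n, A n < x /\ x <= B n.
    near \oo => n; exists n; split; near: n.
      exact: (cvgr_lt 0 cA).
    by move/cvgryPge : cB; exact.
  by exists n => //=; rewrite in_itv/= nB ltW.
apply: ge0_nondecreasing_set_cvg_integral => //.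
- move=> m n mn; apply/subsetPset => x/=; rewrite !in_itv/= => /andP[h1 h2].
  by rewrite (le_trans (dA _ _ mn))// (le_trans h2)// iB.
- by move=> n; apply/measurable_EFinP; apply: measurable_funS mf.
- move=> n x /AD/=; rewrite in_itv/= andbT lee_fin => /f0; exact.
Unshelve. all: by end_near. Qed.

Lemma pos_within_continuous f a b : 0 < a ->
  (forall x : R, 0 < x -> {for x, continuous f}) ->
  {within `[a, b], continuous f}.
Proof.
move=> a0 cf; apply: continuous_in_subspaceT => x.
rewrite inE/= in_itv/= => /andP[ax _]; apply: cf; exact: lt_le_trans ax.
Qed.

Lemma pos_derivable_LR F f a b : 0 < a -> a < b ->
  (forall x : R, 0 < x -> is_derive x 1 F (f x)) ->
  derivable_oo_LRcontinuous F a b.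
Proof.
move=> a0 ab dF.
have cF x : 0 < x -> {for x, continuous F}.
  move=> /dF[dFx _]; exact/differentiable_continuous/derivable1_diffP.
split.
- move=> x; rewrite in_itv/= => /andP[ax _].
  by have [] := dF x (lt_trans a0 ax).
- by apply: cvg_at_right_filter; exact: cF.
- by apply: cvg_at_left_filter; apply: cF; exact: lt_trans ab.
Qed.

Lemma pos_FTC2 F f a b : 0 < a -> a < b ->
  (forall x : R, 0 < x -> is_derive x 1 F (f x)) ->
  (forall x : R, 0 < x -> {for x, continuous f}) ->
  (\int[mu]_(x in `[a, b]) (f x)%:E = (F b - F a)%:E)%E.
Proof.
move=> a0 ab dF cf; rewrite (@continuous_FTC2 _ f F)//.
- exact: pos_within_continuous.
- exact: pos_derivable_LR dF.
- move=> x; rewrite in_itv/= => /andP[ax _].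
  by rewrite derive1E; have [] := dF x (lt_trans a0 ax).
Qed.

Lemma pos_continuous_measurable f :
  (forall x : R, 0 < x -> {for x, continuous f}) -> measurable_fun D f.
Proof.
move=> cf; apply: open_continuous_measurable_fun.
  exact: interval_open.
by move=> x; rewrite inE/= in_itv/= andbT => /cf.
Qed.

(** Stated for extended-real integrals of nonnegative functions, so that integrability of neither
    side has to be known beforehand. *)
Lemma pos_substitution F f G :
  {in D &, {homo F : x y / x < y}} -> (forall x : R, 0 < x -> 0 < F x) ->
  (forall x : R, 0 < x -> is_derive x 1 F (f x)) ->
  (forall x : R, 0 < x -> {for x, continuous f}) ->
  (forall x : R, 0 < x -> 0 <= f x) ->
  F x @[x --> 0^'+] --> (0 : R) -> F x @[x --> +oo%R] --> +oo%R ->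
  (forall x : R, 0 < x -> {for x, continuous G}) ->
  (forall x : R, 0 < x -> 0 <= G x) ->
  (\int[mu]_(x in D) (G x)%:E = \int[mu]_(x in D) (G (F x) * f x)%:E)%E.
Proof.
move=> iF F0 dF cf f0 Fl Fr cG G0.
have Dx x : 0 < x -> x \in D by rewrite inE/= in_itv/= andbT.
pose a (n : nat) : R := n.+1%:R^-1.
pose b (n : nat) : R := n.+1%:R.
have a0 n : 0 < a n by rewrite /a invr_gt0.
have b0 n : 0 < b n by rewrite /b.
have ab n : a n <= b n.
  by rewrite /a /b (@le_trans _ _ 1)// ?invf_le1// ler1n.
have da : nonincreasing_seq a.
  by move=> m n mn; rewrite /a lef_pV2 ?posrE// ler_nat.
have ib : nondecreasing_seq b by move=> m n mn; rewrite /b ler_nat.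
have ca : a @ \oo --> (0 : R) by exact: cvg_harmonic.
have cb : b @ \oo --> +oo%R.
  apply/cvgryPge => M; near=> n; rewrite /b.
  have Mn : M <= n%:R by near: n; exact: nbhs_infty_ger.
  by rewrite (le_trans Mn)// ler_nat.
have iF' x y : 0 < x -> 0 < y -> x <= y -> F x <= F y.
  move=> x0 y0; rewrite le_eqVlt => /predU1P[->//|xy].
  by apply/ltW/iF => //; exact: Dx.
have cF x : 0 < x -> {for x, continuous F}.
  move=> /dF[dFx _]; exact/differentiable_continuous/derivable1_diffP.
have cGF x : 0 < x -> {for x, continuous (fun x => G (F x) * f x)}.
  move=> x0; apply: cvgM; last exact: cf.
  by apply: continuous_comp; [exact: cF|exact/cG/F0].
have h1 : (\int[mu]_(x in `[F (a n), F (b n)]) (G x)%:E)%E @[n --> \oo] -->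
    (\int[mu]_(x in D) (G x)%:E)%E.
  apply: (@integral_exhaustion (F \o a) (F \o b)) => //=.
  - by move=> m n mn /=; apply: iF' => //; exact: da.
  - by move=> m n mn /=; apply: iF' => //; exact: ib.
  - by move=> n; exact: F0.
  - by move/cvg_at_rightP : Fl; apply.
  - exact: (cvg_comp _ _ cb Fr).
  - exact: pos_continuous_measurable.
have h2 : (\int[mu]_(x in `[a n, b n]) (G (F x) * f x)%:E)%E @[n --> \oo] -->
    (\int[mu]_(x in D) (G (F x) * f x)%:E)%E.
  apply: (@integral_exhaustion a b) => //=.
  - exact: pos_continuous_measurable.
  - by move=> x x0; rewrite mulr_ge0 ?f0 ?G0 ?F0.
apply: (cvg_unique _ h1) => //.
apply: cvg_trans h2; apply: near_eq_cvg; apply: nearW => n /=.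
(* For n = 0 the interval is the single point 1, while substitution on a compact interval needs
   distinct endpoints. *)
have [n0|n0] := eqVneq n 0%N.
  have -> : a n = b n by rewrite /a /b n0 invr1.
  by rewrite !set_itv1 !integral_set1.
have abn : a n < b n.
  by rewrite /a /b (@lt_trans _ _ 1)// ?invf_lt1// ltr1n ltnS lt0n.
have dFE x : 0 < x -> derive1 F x = f x.
  by move=> x0; rewrite derive1E; have [] := dF x x0.
have cdF x : 0 < x -> {for x, continuous (derive1 F)}.
  move=> x0; have /(_ x x0) := cf; rewrite /prop_for /continuous_at dFE//.
  apply: cvg_trans; apply: near_eq_cvg; near=> y.
  by rewrite dFE//; near: y; exact: lt_nbhsr.
rewrite (@integration_by_substitution_increasing _ F G (a n) (b n))//.
- apply: eq_integral => x; rewrite inE/= in_itv/= => /andP[ax _].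
  by rewrite !fctE dFE// (lt_le_trans (a0 n)).
- move=> x y; rewrite !in_itv/= => /andP[ax _] /andP[ay _]; apply: iF;
  by apply: Dx; rewrite (lt_le_trans (a0 n)).
- by move=> x; rewrite in_itv/= => /andP[ax _]; apply: cdF; exact: lt_trans ax.
- apply/cvg_ex; exists (derive1 F (a n)).
  by apply: cvg_at_right_filter; exact: cdF.
- apply/cvg_ex; exists (derive1 F (b n)).
  by apply: cvg_at_left_filter; exact: cdF.
- exact: pos_derivable_LR dF.
- by apply: pos_within_continuous => //; exact: F0.
Unshelve. all: by end_near. Qed.

Lemma pos_integrableZ f (c : R) : mu.-integrable D (EFin \o f) ->
  mu.-integrable D (EFin \o (fun t => c * f t)).
Proof.
move=> fi; have fi2 : mu.-integrable D (fun t => (c%:E * (EFin \o f) t)%E).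
  exact: integrableZl.
by apply: eq_integrable fi2.
Qed.

Lemma pos_integrableD f g :
  mu.-integrable D (EFin \o f) -> mu.-integrable D (EFin \o g) ->
  mu.-integrable D (EFin \o (fun t => f t + g t)).
Proof.
move=> fi gi; have fgi : mu.-integrable D ((EFin \o f) \+ (EFin \o g))%E.
  exact: integrableD.
by apply: eq_integrable fgi.
Qed.

Lemma pos_integrableB f g :
  mu.-integrable D (EFin \o f) -> mu.-integrable D (EFin \o g) ->
  mu.-integrable D (EFin \o (fun t => f t - g t)).
Proof.
move=> fi gi; have fgi : mu.-integrable D ((EFin \o f) \- (EFin \o g))%E.
  exact: integrableB.
by apply: eq_integrable fgi.
Qed.

(** The majorant is 2C times the density of the exponential law of rate 1/2. *)
Lemma integrable_expR_decay f (C : R) : measurable_fun D f ->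
  (forall t, 0 < t -> `|f t| <= C * expR (- (t / 2))) ->
  mu.-integrable D (EFin \o f).
Proof.
move=> mf fC.
have ie : mu.-integrable D (EFin \o (fun t => C * expR (- (t / 2)))).
  have /(@integrable_exponential_pdf R) : 0 < 2^-1 :> R by [].
  move=> ip0.
  have ip : mu.-integrable D (EFin \o exponential_pdf 2^-1).
    exact: (integrableS _ _ _ ip0).
  apply: eq_integrable (pos_integrableZ (C * 2) ip) => //.
  move=> t; rewrite inE/= in_itv/= andbT => t0.
  rewrite /= exponential_pdfE ?ltW//; congr EFin.
  by rewrite mulrA mulfK// mulNr [2^-1 * t]mulrC.
apply: (le_integrable _ _ _ ie) => //; first exact/measurable_EFinP.
move=> t/=; rewrite in_itv/= andbT => t0; rewrite lee_fin.
by rewrite (le_trans (fC _ t0))// ler_norm.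
Qed.

End PositiveHalfLine.

(** * The Euler integral *)

Section EulerIntegral.
Context {R : realType}.
Notation mu := (@lebesgue_measure R).
Notation D := (`]0%R, +oo[%classic : set R).
Implicit Types (z p t : R).

(** This is h^N / N! <= e^h at h = (1 + t)/2; half of the decay of e^(-t) thus remains for
    integrability. *)
Lemma exprn_1D_le_expR (N : nat) t : 0 < t ->
  (1 + t) ^+ N <= 2 ^+ N * N`!%:R * expR (1 / 2) * expR (t / 2).
Proof.
move=> t0; rewrite -mulrA -expRD -mulrDl.
have h0 : 0 <= (1 + t) / 2 by lra.
have N0 : 0 < N`!%:R :> R by rewrite ltr0n fact_gt0.
have : ((1 + t) / 2) ^+ N / N`!%:R <= expR ((1 + t) / 2).
  case: N N0 => [_|N N0].
    rewrite expr0 fact0 divr1 (le_trans _ (expR_ge1Dx _))//; lra.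
  by rewrite (le_trans _ (expR_ge1Dxn N h0))// lerDr.
rewrite ler_pdivrMr// expr_div_n ler_pdivrMr ?exprn_gt0//.
by move/le_trans; apply; rewrite le_eqVlt; apply/orP; left; apply/eqP; ring.
Qed.

Lemma powR_le_1D (N : nat) p t : 0 <= p <= N%:R -> 0 < t -> t `^ p <= (1 + t) ^+ N.
Proof.
move=> /andP[p0 pN] t0; have t1 : 1 <= 1 + t by lra.
rewrite -powR_mulrn; last lra.
rewrite (le_trans _ (ler_powR t1 pN))//.
by rewrite ge0_ler_powR ?nnegrE//; lra.
Qed.

Lemma powR_le_expR (N : nat) : exists2 C : R, 0 < C &
  forall p t, 0 <= p <= N%:R -> 0 < t -> t `^ p <= C * expR (t / 2).
Proof.
exists (2 ^+ N * N`!%:R * expR (1 / 2)) => [|p t pN t0].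
  by rewrite !mulr_gt0 ?expR_gt0 ?exprn_gt0// ltr0n fact_gt0.
exact: le_trans (powR_le_1D pN t0) (exprn_1D_le_expR _ t0).
Qed.

Definition euler_fun z t : R := t `^ (z - 1) * expR (- t).

Lemma is_derive_expRN (x : R) : is_derive x 1 (fun t : R => expR (- t)) (- expR (- x)).
Proof.
have := is_derive1_comp (is_derive_expR (- x)) (is_deriveN (is_derive_id x 1)).
by rewrite mulrN1.
Qed.

Lemma is_derive_euler_fun z t : 0 < t ->
  is_derive t 1 (euler_fun z) ((z - 1) * euler_fun (z - 1) t - euler_fun z t).
Proof.
move=> t0.
have h := is_deriveM (is_derive1_powR (z - 1) t0) (is_derive_expRN t).
apply: is_derive_eq h _.
by rewrite /euler_fun /GRing.scale/=; ring.
Qed.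

Lemma continuous_euler_fun z t : 0 < t -> {for t, continuous (euler_fun z)}.
Proof.
move=> /(is_derive_euler_fun z)[d _].
exact/differentiable_continuous/derivable1_diffP.
Qed.

Lemma measurable_euler_fun z : measurable_fun D (euler_fun z).
Proof. by apply: pos_continuous_measurable => t /continuous_euler_fun. Qed.

Lemma euler_fun_ge0 z t : 0 <= euler_fun z t.
Proof. by rewrite mulr_ge0 ?powR_ge0 ?expR_ge0. Qed.

Lemma integrable_euler_fun_ge1 z : 1 <= z -> mu.-integrable D (EFin \o euler_fun z).
Proof.
move=> z1; have [C C0 hC] := powR_le_expR (Num.truncn (z - 1)).+1.
apply: (integrable_expR_decay (C := C) (measurable_euler_fun z)) => t t0.
rewrite ger0_norm ?euler_fun_ge0// /euler_fun.
have := hC (z - 1) t; rewrite subr_ge0 z1 ltW ?truncnS_gt// => /(_ isT t0) h.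
rewrite (le_trans (ler_wpM2r (expR_ge0 _) h))// -mulrA -expRD.
by rewrite le_eqVlt; apply/orP; left; apply/eqP; congr (_ * expR _); lra.
Qed.

Lemma cvg_euler_fun_at0 z : 1 < z -> euler_fun z t @[t --> 0^'+] --> (0 : R).
Proof.
move=> z1; rewrite -[X in _ --> X](mul0r (expR (- 0))).
apply: cvgM; first by apply: powR_cvg0; rewrite subr_gt0.
apply: cvg_at_right_filter.
have [d _] := is_derive_expRN 0.
by have /derivable1_diffP/differentiable_continuous := d.
Qed.

Lemma cvg_euler_funy z : 1 < z -> euler_fun z t @[t --> +oo%R] --> (0 : R).
Proof.
move=> z1; have [C C0 hC] := powR_le_expR (Num.truncn (z - 1)).+1.
apply: (@squeeze_cvgr _ _ _ _ (cst 0) (fun t => C * expR (- (t / 2)))).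
- near=> t; rewrite euler_fun_ge0/= /euler_fun.
  have t0 : 0 < t by near: t; exact: nbhs_pinfty_gt.
  have := hC (z - 1) t; rewrite subr_ge0 (ltW z1) ltW ?truncnS_gt// => /(_ isT t0) h.
  rewrite (le_trans (ler_wpM2r (expR_ge0 _) h))// -mulrA -expRD.
  by rewrite le_eqVlt; apply/orP; left; apply/eqP; congr (_ * expR _); lra.
- exact: cvg_cst.
- rewrite -[X in _ --> X](mulr0 C); apply: cvgMl_tmp.
  apply: (cvg_comp (fun t : R => t / 2) (fun t => expR (- t))); last exact: cvgr_expR.
  by apply: gt0_cvgMly => //; exact: cvg_id.
Unshelve. all: by end_near. Qed.

(** Integration by parts: t^z e^(-t) has derivative [z * euler_fun z t - euler_fun (z + 1) t] and
    vanishes at both ends. Both sides are extended reals, because integrability for z < 1 is only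
    deduced from this identity. *)
Lemma integral_euler_fun_rec z : 0 < z ->
  (\int[mu]_(t in D) (z * euler_fun z t)%:E =
   \int[mu]_(t in D) (euler_fun (z + 1) t)%:E)%E.
Proof.
move=> z0.
(* Starting at 2 keeps the endpoints distinct for every n. *)
pose a (n : nat) : R := n.+2%:R^-1.
pose b (n : nat) : R := n.+2%:R.
have a0 n : 0 < a n by rewrite /a invr_gt0.
have ab n : a n < b n.
  by rewrite /a /b (@lt_trans _ _ 1)// ?invf_lt1// ltr1n.
have da : nonincreasing_seq a.
  by move=> m n mn; rewrite /a lef_pV2 ?posrE// ler_nat.
have ib : nondecreasing_seq b by move=> m n mn; rewrite /b ler_nat.
have ca : a @ \oo --> (0 : R).
  by have := @cvg_harmonic R; rewrite -cvg_shiftS.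
have cb : b @ \oo --> +oo%R.
  apply/cvgryPge => M; near=> n; rewrite /b.
  have Mn : M <= n%:R by near: n; exact: nbhs_infty_ger.
  by rewrite (le_trans Mn)// ler_nat -addn2 leq_addr.
have h1 := integral_exhaustion da ib a0 ca cb
  (measurable_funM (@measurable_cst _ _ _ _ D z) (measurable_euler_fun z)).
have {}h1 := h1 (fun t _ => mulr_ge0 (ltW z0) (euler_fun_ge0 z t)).
have h2 := integral_exhaustion da ib a0 ca cb
  (measurable_euler_fun (z + 1)) (fun t _ => euler_fun_ge0 (z + 1) t).
have h3 : (euler_fun (z + 1) (b n) - euler_fun (z + 1) (a n))%:E @[n --> \oo]
    --> 0%E.
  rewrite -[0%E]/((0 : R)%:E) -[X in X%:E](subrr 0); apply: cvg_EFin.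
    by apply: nearW.
  apply: cvgB.
    apply: (cvg_comp _ _ cb); apply: cvg_euler_funy; lra.
  have /cvg_at_rightP := @cvg_euler_fun_at0 (z + 1) ltac:(lra).
  by apply; split.
have def0 : ((\int[mu]_(t in D) (euler_fun (z + 1) t)%:E) +? 0)%E.
  exact: fin_num_adde_defl.
have h4 : ((\int[mu]_(t in `[a n, b n]) (euler_fun (z + 1) t)%:E) +
      (euler_fun (z + 1) (b n) - euler_fun (z + 1) (a n))%:E)%E @[n --> \oo] -->
    ((\int[mu]_(t in D) (euler_fun (z + 1) t)%:E) + 0)%E.
  exact: (cvgeD def0 h2 h3).
rewrite adde0 in h4.
apply: (cvg_unique _ h1) => //.
apply: cvg_trans h4; apply: near_eq_cvg; apply: nearW => n /=.
have sub : `[a n, b n]%classic `<=` D.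
  by move=> x/=; rewrite !in_itv/= andbT => /andP[+ _]; exact: lt_le_trans.
have cint y : mu.-integrable `[a n, b n] (EFin \o euler_fun y).
  apply: continuous_compact_integrable; first exact: segment_compact.
  apply: pos_within_continuous => //.
  by move=> x /continuous_euler_fun.
have dif : (\int[mu]_(t in `[a n, b n])
      (z * euler_fun z t - euler_fun (z + 1) t)%:E)%E =
    (euler_fun (z + 1) (b n) - euler_fun (z + 1) (a n))%:E.
  apply: pos_FTC2 => //.
  - by move=> x x0; have := is_derive_euler_fun (z + 1) x0; rewrite addrK.
  - move=> x x0; apply: cvgB; last exact: continuous_euler_fun.
    by apply: cvgMl_tmp; exact: continuous_euler_fun.
rewrite -dif; under [X in (_ + X)%E]eq_integral do rewrite EFinB.
rewrite integralB//; last 2 first.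
- apply: (continuous_compact_integrable (f := fun t => z * euler_fun z t)).
    exact: segment_compact.
  apply: pos_within_continuous => // x x0.
  by apply: cvgMl_tmp; exact: continuous_euler_fun.
- exact: cint.
rewrite addeC; apply: subeK.
exact: integrable_fin_num (cint (z + 1)).
Unshelve. all: by end_near. Qed.

Lemma integrable_euler_fun z : 0 < z -> mu.-integrable D (EFin \o euler_fun z).
Proof.
move=> z0; have i1 := @integrable_euler_fun_ge1 (z + 1) ltac:(lra).
have iz : mu.-integrable D (EFin \o (fun t => z * euler_fun z t)).
  apply/integrableP; split.
    apply/measurable_EFinP; apply: measurable_funM; first exact: measurable_cst.
    exact: measurable_euler_fun.
  rewrite [X in (X < _)%E](_ : _ = (\int[mu]_(t in D) (z * euler_fun z t)%:E)%E).
    rewrite integral_euler_fun_rec// ltey_eq; apply/orP; left.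
    exact: (integrable_fin_num _ i1).
  apply: eq_integral => t _ /=.
  by rewrite ger0_norm// mulr_ge0 ?euler_fun_ge0// ltW.
apply: eq_integrable (pos_integrableZ z^-1 iz) => //.
by move=> t _ /=; rewrite mulKf// gt_eqF.
Qed.

Lemma euler_integral_rec z : 0 < z -> euler_integral (z + 1) = z * euler_integral z.
Proof.
move=> z0; rewrite {1}/euler_integral -/(euler_fun _ _).
rewrite /Rintegral -(integral_euler_fun_rec z0).
by rewrite -RintegralZl//; exact: integrable_euler_fun.
Qed.

Lemma euler_integral_ge0 z : 0 <= euler_integral z.
Proof. by apply: Rintegral_ge0 => t _; exact: euler_fun_ge0. Qed.

Lemma euler_integral_1 : euler_integral (1 : R) = 1.
Proof.
rewrite /euler_integral /Rintegral.
have -> : (\int[mu]_(t in D) (t `^ (1 - 1) * expR (- t))%:E =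
           \int[mu]_(t in `[0%R, +oo[) (expR (- t))%:E)%E.
  rewrite -integral_itv_obnd_cbnd//=.
    by apply: eq_integral => t _; rewrite subrr powRr0 mul1r.
  apply/measurable_EFinP; apply: pos_continuous_measurable => t _.
  by have [/derivable1_diffP/differentiable_continuous] := is_derive_expRN t.
rewrite (@ge0_continuous_FTC2y _ _ (fun t => - expR (- t)) 0 0)//=.
- by rewrite oppr0 expR0 opprK add0r.
- apply: continuous_subspaceT => t.
  by have [/derivable1_diffP/differentiable_continuous] := is_derive_expRN t.
- by rewrite -oppr0; apply: cvgN; exact: cvgr_expR.
- apply: cvgN; apply: cvg_at_right_filter.
  by have [/derivable1_diffP/differentiable_continuous] := is_derive_expRN 0.
- move=> x _; rewrite derive1E; have h := is_deriveN (is_derive_expRN x).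
  by have [_ ->] := h; rewrite opprK.
Qed.

(* Weighted AM-GM, [t^s <= (1 - s) z^s + s z^(s-1) t], integrated against
   [t^(z-1) e^-t]; it replaces the log-convexity of the Gamma function. *)
Lemma euler_integral_shift_le z s : 0 < z -> 0 <= s <= 1 ->
  euler_integral (z + s) <= z `^ s * euler_integral z.
Proof.
move=> z0 /andP[]; rewrite le_eqVlt => /predU1P[<- _|s0].
  by rewrite addr0 powRr0 mul1r.
rewrite le_eqVlt => /predU1P[->|s1].
  by rewrite euler_integral_rec// powRr1 ?(ltW z0)//.
have zs : z `^ s * euler_integral z =
    ((1 - s) * z `^ s) * euler_integral z + (s * z `^ s / z) * euler_integral (z + 1).
  by rewrite euler_integral_rec//; field; rewrite gt_eqF.
have i0 := integrable_euler_fun z0.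
have i1 : mu.-integrable D (EFin \o euler_fun (z + 1)).
  by apply: integrable_euler_fun; lra.
rewrite zs -!RintegralZl// -RintegralD//; last 2 first.
- exact: pos_integrableZ.
- exact: pos_integrableZ.
apply: le_Rintegral => //.
- by apply: integrable_euler_fun; lra.
- by apply: pos_integrableD; exact: pos_integrableZ.
move=> t /=; rewrite in_itv/= andbT => t0.
have -> : t `^ (z + s - 1) = t `^ (z - 1) * t `^ s.
  by rewrite -powRD ?(gt_eqF t0) ?implybT//; congr (_ `^ _); ring.
have -> : t `^ (z + 1 - 1) = t `^ (z - 1) * t.
  rewrite -[X in _ * X]powRr1 ?ltW// -powRD ?(gt_eqF t0) ?implybT//; congr (_ `^ _); ring.
have key : t `^ s <= (1 - s) * z `^ s + s * z `^ s / z * t.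
  have tz : 0 < t / z by rewrite divr_gt0.
  have := @conjugate_powR R ((t / z) `^ s) 1 s^-1 (1 - s)^-1 (powR_ge0 _ _) ler01.
  rewrite !invr_gt0 subr_gt0 !invrK => /(_ s0 s1 (subrKC _ _)).
  have one y : (1 : R) `^ y = 1 by rewrite powR1.
  rewrite -powRrM divff ?gt_eqF// powRr1 ?(ltW tz)// one mulr1 mul1r => h.
  have zs0 : 0 < z `^ s by rewrite powR_gt0.
  have -> : t `^ s = z `^ s * (t / z) `^ s.
    by rewrite -powRM ?ltW// mulrC divfK// gt_eqF.
  rewrite (le_trans (ler_wpM2l (ltW zs0) h))// le_eqVlt; apply/orP; left.
  by apply/eqP; ring.
have w0 : 0 <= t `^ (z - 1) * expR (- t) by exact: euler_fun_ge0.
have -> : t `^ (z - 1) * t `^ s * expR (- t) = t `^ (z - 1) * expR (- t) * t `^ s by ring.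
rewrite (le_trans (ler_wpM2l w0 key))// le_eqVlt; apply/orP; left.
by apply/eqP; ring.
Qed.

(** For z <= 1, a zero at z would force the value 1 at the point 1 to be at most 0, by the shift
    inequality with s = 1 - z. Larger z follow from the functional equation. *)
Lemma euler_integral_gt0 z : 0 < z -> 0 < euler_integral z.
Proof.
move=> z0; rewrite lt_neqAle euler_integral_ge0 andbT eq_sym.
have [n] : exists n : nat, z <= n%:R.
  by exists (Num.truncn z).+1; rewrite ltW// truncnS_gt.
elim: n z z0 => [z z0|n IH z z0 zn]; first by rewrite leNgt z0.
have [z1|z1] := leP z 1.
  apply/negP => /eqP Ez.
  have := @euler_integral_shift_le z (1 - z) z0.
  rewrite subrKC euler_integral_1 Ez mulr0 => /(_ ltac:(lra)); lra.
rewrite -[z](subrK 1) euler_integral_rec ?subr_gt0// mulf_neq0//.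
  by rewrite gt_eqF// subr_gt0.
by apply: IH; [lra | rewrite -natr1 in zn; lra].
Qed.

Lemma integral_gauss_pos :
  (\int[mu]_(s in D) (expR (- s ^+ 2))%:E = (Num.sqrt pi / 2)%:E)%E.
Proof.
rewrite -integral0y_gauss integral_itv_obnd_cbnd//.
by apply/measurable_EFinP/measurable_funTS; exact: measurable_gauss_fun.
Qed.

(** The substitution t = s^2, used both for the value at 1/2 and for the moments of
    [gauss_weight]. *)
Lemma integral_powR_gauss z :
  (\int[mu]_(t in D) (euler_fun z t)%:E =
   \int[mu]_(s in D) (s `^ (z *+ 2 - 1) * expR (- s ^+ 2) * 2)%:E)%E.
Proof.
transitivity (\int[mu]_(s in D) (euler_fun z (s ^+ 2) * (s *+ 2))%:E)%E.
  apply: (@pos_substitution _ (fun s => s ^+ 2) (fun s => s *+ 2) (euler_fun z)).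
  - move=> x y; rewrite !inE/= !in_itv/= !andbT => x0 y0 xy.
    by rewrite ltr_pXn2r// nnegrE ltW.
  - by move=> x x0; rewrite exprn_gt0.
  - move=> x x0; have h := is_deriveM (is_derive_id x 1) (is_derive_id x 1).
    by apply: is_derive_eq h _; rewrite /GRing.scale/= mulr1.
  - by move=> x _; apply: (@cvgMn _ _ _ _ _ id); exact: cvg_id.
  - by move=> x x0; rewrite mulrn_wge0// ltW.
  - rewrite -[X in _ --> X](expr0n _ 2); apply: cvg_at_right_filter.
    exact: exprn_continuous.
  - exact: cvgr_expr2.
  - exact: continuous_euler_fun.
  - by move=> x _; exact: euler_fun_ge0.
apply: eq_integral => s; rewrite inE/= in_itv/= andbT => s0; congr EFin.
have -> : s `^ (z *+ 2 - 1) = (s ^+ 2) `^ (z - 1) * s.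
  rewrite -powR_mulrn ?ltW// -powRrM.
  rewrite -[X in _ = _ * X]powRr1 ?ltW// -powRD ?(gt_eqF s0) ?implybT//.
  by congr (_ `^ _); ring.
by rewrite /euler_fun; ring.
Qed.

Lemma euler_integral_half : euler_integral (1 / 2 : R) = Num.sqrt pi.
Proof.
rewrite /euler_integral /Rintegral integral_powR_gauss.
have -> : (1 / 2 : R) *+ 2 - 1 = 0 by rewrite -mulr_natr; lra.
under eq_integral => s _ do rewrite powRr0 mul1r mulrC EFinM.
rewrite ge0_integralZl//.
- by rewrite integral_gauss_pos/= mulrC divfK.
- by apply/measurable_EFinP/measurable_funTS; exact: measurable_gauss_fun.
Qed.

End EulerIntegral.

(** * The duplication formula *)

(** The left side is (z (z+1))^(d/2) <= (z+1)^d = (z+1) (z+1)^(d-1), and the exponent d - 1 <= 0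
    allows z + 1 to be lowered to z + d. It collects the powers arising in
    [duplication_ratio_le]. *)
Lemma powR_bracket {R : realType} (z d : R) : 0 < z -> 0 <= d -> d <= 1 ->
  (z / 2) `^ (d / 2) * ((z + 1) / 2) `^ (d / 2) * 2 `^ d
    <= (z + 1) * (z + d) `^ (d - 1).
Proof.
move=> z0 d0 d1.
have -> : (2 : R) `^ d = 4 `^ (d / 2).
  rewrite (_ : 4 = 2 `^ 2) -?powRrM; first by congr (_ `^ _); field.
  by rewrite powR_mulrn// -natrX.
rewrite -powRM; [|lra|lra].
rewrite -powRM; [|by rewrite mulr_ge0; lra|lra].
have -> : z / 2 * ((z + 1) / 2) * 4 = z * (z + 1) by field.
have u1 : (z * (z + 1)) `^ (d / 2) <= (z + 1) `^ d.
  have -> : (z + 1) `^ d = ((z + 1) ^+ 2) `^ (d / 2).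
    rewrite -powR_mulrn; last lra.
    by rewrite -powRrM; congr (_ `^ _); field.
  by apply: ge0_ler_powR; rewrite ?nnegrE ?mulr_ge0 ?exprn_ge0//; lra.
apply: (le_trans u1).
have -> : (z + 1) `^ d = (z + 1) * (z + 1) `^ (d - 1).
  rewrite -[X in _ = X * _]powRr1; last lra.
  rewrite -powRD; last by apply/implyP => _; rewrite gt_eqF//; lra.
  by congr (_ `^ _); ring.
rewrite ler_pM2l; last lra.
rewrite -[d - 1]opprB !powRN lef_pV2 ?posrE ?powR_gt0; try lra.
by apply: ge0_ler_powR; rewrite ?nnegrE; lra.
Qed.

Section Duplication.
Context {R : realType} (E : R -> R)
  (E_gt0 : forall z, 0 < z -> 0 < E z)
  (E_rec : forall z, 0 < z -> E (z + 1) = z * E z)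
  (E_shift_le : forall z s, 0 < z -> 0 <= s <= 1 -> E (z + s) <= z `^ s * E z).
Implicit Types (z d : R).

(** The upper bound applied at z + s with the complementary shift 1 - s, which lands on z + 1. *)
Lemma gammalike_shift_ge z s : 0 < z -> 0 <= s <= 1 ->
  z * (z + s) `^ (s - 1) * E z <= E (z + s).
Proof.
move=> z0 /andP[s0 s1]; have zs0 : 0 < z + s by lra.
have := @E_shift_le (z + s) (1 - s) zs0.
have -> : z + s + (1 - s) = z + 1 by ring.
rewrite E_rec// => /(_ ltac:(lra)) h.
have p0 : 0 < (z + s) `^ (s - 1) by rewrite powR_gt0.
rewrite mulrAC -ler_pdivlMr// (le_trans h)// -powRN opprB mulrC//.
Qed.

Lemma gammalike_rising z k : 0 < z -> E (z + k%:R) = rising z k * E z.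
Proof.
move=> z0; elim: k => [|k IH]; first by rewrite addr0 /rising big_ord0 mul1r.
have zk : 0 < z + k%:R by rewrite ltr_wpDr.
by rewrite -natr1 addrA E_rec// IH risingSr mulrCA mulrA.
Qed.

(* Nonincreasing and periodic, hence constant. *)
Definition duplication_ratio z : R :=
  E (z / 2) * E ((z + 1) / 2) * 2 `^ z
  / E z.

Lemma duplication_ratio_periodic z : 0 < z ->
  duplication_ratio (z + 2) = duplication_ratio z.
Proof.
move=> z0; rewrite /duplication_ratio.
have -> : (z + 2) / 2 = z / 2 + 1 by field.
have -> : (z + 2 + 1) / 2 = (z + 1) / 2 + 1 by field.
have -> : z + 2 = z + 1 + 1 by ring.
rewrite !E_rec; try lra.
have -> : (2 : R) `^ (z + 1 + 1) = 2 `^ z * 4.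
  by rewrite -addrA powRD ?pnatr_eq0 ?implybT// -[1 + 1]/(2%:R) powR_mulrn// -natrX.
have E0 := E_gt0 z0; field.
by rewrite !gt_eqF//; lra.
Qed.

Lemma duplication_ratio_gt0 z : 0 < z -> 0 < duplication_ratio z.
Proof.
move=> z0; rewrite /duplication_ratio divr_gt0 ?mulr_gt0 ?powR_gt0//;
  by apply: E_gt0; lra.
Qed.

(** Upper shift bounds for the two numerator factors, the lower one for the denominator. The loss
    (z+1)/z tends to 1 at infinity, so periodicity can remove it. *)
Lemma duplication_ratio_le z d : 0 < z -> 0 <= d <= 1 ->
  duplication_ratio (z + d) <= duplication_ratio z * ((z + 1) / z).
Proof.
move=> z0 /andP[d0 d1].
have h1 := @E_shift_le (z / 2) (d / 2) ltac:(lra) ltac:(lra).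
have h2 := @E_shift_le ((z + 1) / 2) (d / 2) ltac:(lra) ltac:(lra).
have h3 := @gammalike_shift_ge z d z0 ltac:(lra).
have e1 := @E_gt0 (z / 2) ltac:(lra).
have e2 := @E_gt0 ((z + 1) / 2) ltac:(lra).
have e3 := E_gt0 z0.
have f1 := @E_gt0 (z / 2 + d / 2) ltac:(lra).
have f2 := @E_gt0 ((z + 1) / 2 + d / 2) ltac:(lra).
have f3 := @E_gt0 (z + d) ltac:(lra).
rewrite /duplication_ratio (_ : (z + d + 1) / 2 = (z + 1) / 2 + d / 2); last by field.
rewrite (_ : (z + d) / 2 = z / 2 + d / 2); last by field.
rewrite powRD ?pnatr_eq0 ?implybT//.
set A := E (z / 2) in h1 e1 *.
set B := E ((z + 1) / 2) in h2 e2 *.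
set E0 := E z in h3 e3 *.
set A' := E (z / 2 + d / 2) in h1 f1 *.
set B' := E ((z + 1) / 2 + d / 2) in h2 f2 *.
set E' := E (z + d) in h3 f3 *.
have T0 : 0 < (2 : R) `^ z by rewrite powR_gt0.
have w0 : 0 < z * (z + d) `^ (d - 1) * E0.
  by rewrite !mulr_gt0// powR_gt0//; lra.
have step1 : A' * B' * (2 `^ z * 2 `^ d) / E' <=
    ((z / 2) `^ (d / 2) * A) * (((z + 1) / 2) `^ (d / 2) * B) * (2 `^ z * 2 `^ d)
    / (z * (z + d) `^ (d - 1) * E0).
  apply: ler_pM.
  - by rewrite !mulr_ge0 ?powR_ge0// ltW.
  - by rewrite invr_ge0 ltW.
  - apply: ler_wpM2r; first by rewrite mulr_ge0 ?powR_ge0.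
    by apply: ler_pM => //; exact: ltW.
  - by rewrite lef_pV2 ?posrE.
apply: (le_trans step1).
have bracket := powR_bracket z0 d0 d1.
have p0 : 0 < (z + d) `^ (d - 1) by rewrite powR_gt0//; lra.
have K0 : 0 <= A * B * 2 `^ z / (z * (z + d) `^ (d - 1) * E0).
  by rewrite divr_ge0 ?mulr_ge0 ?powR_ge0// ltW.
have := ler_wpM2l K0 bracket.
apply: etrans; congr (_ <= _); first by ring.
by field; rewrite !gt_eqF.
Qed.

Lemma duplication_ratio_periodicn z n : 0 < z ->
  duplication_ratio (z + (n * 2)%:R) = duplication_ratio z.
Proof.
move=> z0; elim: n => [|n IH]; first by rewrite addr0.
rewrite mulSn natrD addrCA addrC duplication_ratio_periodic//.
by rewrite ltr_wpDr.
Qed.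

(** Moving both points by 2n leaves the two ratios unchanged, while the factor between them becomes
    1 + 1/(z + 2n). *)
Lemma duplication_ratio_antitone z y : 0 < z -> z <= y <= z + 1 ->
  duplication_ratio y <= duplication_ratio z.
Proof.
move=> z0 /andP[zy yz]; rewrite leNgt; apply/negP => lt.
set r := duplication_ratio z in lt *; set s := duplication_ratio y in lt *.
have r0 : 0 < r by exact: duplication_ratio_gt0.
have sr : 0 < s - r by lra.
(* With w = z + 2n >= n this yields r/w < s - r, contradicting s <= r + r/w. *)
have [n nlt] : exists n : nat, r / (s - r) < n%:R.
  by exists (Num.truncn (r / (s - r))).+1; exact: truncnS_gt.
have zn : 0 < z + (n * 2)%:R by rewrite ltr_wpDr.
have := @duplication_ratio_le (z + (n * 2)%:R) (y - z) zn ltac:(lra).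
rewrite addrAC subrKC !duplication_ratio_periodicn//; last lra.
rewrite -/r -/s; set w := z + _ in zn *; apply/negP; rewrite -ltNge.
have -> : r * ((w + 1) / w) = r + r / w by field; rewrite gt_eqF.
rewrite -ltrBrDl ltr_pdivrMr// mulrC -ltr_pdivrMr//.
by rewrite (lt_le_trans nlt)// /w ler_wpDl ?(ltW z0)// ler_nat leq_pmulr.
Qed.

(** Chains of comparisons over distance at most 1, closed by the period: for z <= 1 they run z, 1,
    2, z + 2, and for 1 < z <= 2 they run 1, z, z + 1, 3. The constant is the value at 1. *)
Lemma duplication_ratioE z : 0 < z -> duplication_ratio z = 2 * E (1 / 2).
Proof.
move=> z0.
have r1 : duplication_ratio 1 = 2 * E (1 / 2).
  rewrite /duplication_ratio -[1 + 1]/(2 : R) divff// powRr1//.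
  by have := @E_gt0 1 ltac:(lra); move=> e1; field; rewrite gt_eqF.
rewrite -r1; have [n] : exists n : nat, z <= n%:R.
  by exists (Num.truncn z).+1; rewrite ltW// truncnS_gt.
elim: n z z0 => [z z0|n IH z z0 zn]; first by rewrite leNgt z0.
have [z1|z1] := leP z 1.
  apply/le_anti/andP; split; last by apply: duplication_ratio_antitone; lra.
  rewrite -duplication_ratio_periodic//.
  rewrite (@le_trans _ _ (duplication_ratio 2))//;
    by apply: duplication_ratio_antitone; lra.
have [z2|z2] := leP z 2.
  apply/le_anti/andP; split; first by apply: duplication_ratio_antitone; lra.
  rewrite -(@duplication_ratio_periodic 1)//.
  rewrite (@le_trans _ _ (duplication_ratio (z + 1)))//;
    by apply: duplication_ratio_antitone; lra.
rewrite -[z](subrK 2) duplication_ratio_periodic; last lra.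
by apply: IH; rewrite -natr1 in zn; lra.
Qed.

Lemma gammalike_duplication z : 0 < z ->
  2 `^ (- z) * E (1 / 2) =
  E (z / 2) * E ((z + 1) / 2) / (2 * E z).
Proof.
move=> z0; have := duplication_ratioE z0.
have E0 := E_gt0 z0.
have T0 : 0 < (2 : R) `^ z by rewrite powR_gt0.
rewrite /duplication_ratio powRN => h.
have -> : E (1 / 2) = 2 * E (1 / 2) / 2 by field.
by rewrite -h; field; rewrite !gt_eqF.
Qed.

End Duplication.

(** * The reciprocal Gamma function on the whole real line *)

Section Gamma.
Context {R : realType}.
Implicit Types (z d : R).

Lemma Gamma_gt0E z : 0 < z -> Gamma z = euler_integral z.
Proof.
move=> z0; rewrite /Gamma.
have -> : Num.truncn (1 - z) = 0%N.
  by apply/truncn0Pn; rewrite -ltNge gtrDl oppr_lt0.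
by rewrite big_ord0 divr1 addr0.
Qed.

(** Valid at the poles too, where both sides are 0; the recurrence for the Hermite function thus
    needs no exceptional values of nu. For z <= 0, passing from z to z + 1 drops exactly the factor
    z from the product. *)
Lemma invGamma_rec z : (Gamma z)^-1 = z / Gamma (z + 1).
Proof.
have [z0|z0] := ltP 0 z.
  rewrite !Gamma_gt0E//; last lra.
  by rewrite euler_integral_rec// invfM mulrA divff ?mul1r// gt_eqF.
rewrite /Gamma (_ : 1 - (z + 1) = - z); last by ring.
have -> : Num.truncn (1 - z) = (Num.truncn (- z)).+1.
  by rewrite truncnD ?nnegrE ?oppr_ge0 ?rpred1// truncn1.
set n := Num.truncn _.
rewrite -natr1 (_ : z + (n%:R + 1) = z + 1 + n%:R); last by ring.
rewrite big_ord_recl/= addr0.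
have -> : \prod_(i < n) (z + (bump 0 i)%:R) = \prod_(i < n) (z + 1 + i%:R).
  by apply: eq_bigr => i _; rewrite /bump/= natrD addrA.
by rewrite !invfM !invrK; ring.
Qed.

Lemma euler_integral_duplication z : 0 < z ->
  2 `^ (- z) * Num.sqrt pi =
  euler_integral (z / 2) * euler_integral ((z + 1) / 2) / (2 * euler_integral z).
Proof.
move=> z0; rewrite -euler_integral_half; apply: gammalike_duplication => //.
- exact: euler_integral_gt0.
- exact: euler_integral_rec.
- exact: euler_integral_shift_le.
Qed.

Lemma euler_integral_rising z k : 0 < z ->
  euler_integral (z + k%:R) = rising z k * euler_integral z.
Proof. by apply: gammalike_rising; exact: euler_integral_rec. Qed.

End Gamma.

(** * Integral representation of the Hermite function *)

Section HermiteIntegral.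
Context {R : realType}.
Notation mu := (@lebesgue_measure R).
Notation D := (`]0%R, +oo[%classic : set R).
Implicit Types (q x s : R).

Definition gauss_weight q s : R := s `^ (q - 1) * expR (- s ^+ 2).

Lemma gauss_weight_ge0 q s : 0 <= gauss_weight q s.
Proof. by rewrite mulr_ge0 ?powR_ge0 ?expR_ge0. Qed.

Lemma measurable_gauss_weight q : measurable_fun D (gauss_weight q).
Proof.
apply: measurable_funM; first by apply: measurable_funTS; exact: measurable_powR.
by apply: measurable_funTS; exact: measurable_gauss_fun.
Qed.

(** Completing the square in 2|x|s - s^2 + s. *)
Lemma gauss_weight_decay q x s : 0 < s ->
  gauss_weight q s * expR (`|2 * x * s|) <=
  expR ((2 * `|x| + 1) ^+ 2 / 4) * euler_fun q s.
Proof.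
move=> s0; rewrite /gauss_weight /euler_fun -mulrA -expRD mulrCA -expRD.
rewrite ler_wpM2l ?powR_ge0// ler_expR.
rewrite !normrM (gtr0_norm s0) (ger0_norm (ler0n _ _)).
have := sqr_ge0 (s - (2 * `|x| + 1) / 2); rewrite !expr2; lra.
Qed.

Lemma integrable_gauss_weight_le q x (f : R -> R) : 0 < q ->
  measurable_fun D f -> (forall s, 0 < s -> `|f s| <= expR (`|2 * x * s|)) ->
  mu.-integrable D (EFin \o (fun s => gauss_weight q s * f s)).
Proof.
move=> q0 mf fx.
have ig := pos_integrableZ (expR ((2 * `|x| + 1) ^+ 2 / 4)) (integrable_euler_fun q0).
apply: (le_integrable _ _ _ ig) => //.
  by apply/measurable_EFinP; apply: measurable_funM => //; exact: measurable_gauss_weight.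
move=> s/=; rewrite in_itv/= andbT => s0; rewrite lee_fin normrM.
rewrite (ger0_norm (gauss_weight_ge0 _ _)).
rewrite (le_trans (ler_wpM2l (gauss_weight_ge0 _ _) (fx _ s0)))//.
by rewrite (le_trans (gauss_weight_decay q x s0))// ler_norm.
Qed.

Lemma exp_coeff_le_expR (y : R) k : `|exp_coeff y k| <= expR `|y|.
Proof.
rewrite /exp_coeff/= normrM normrX normfV (ger0_norm (ler0n _ _)).
case: k => [|k]; first by rewrite expr0 mul1r fact0 invr1 (le_trans _ (expR_ge1Dx _))// lerDl.
by rewrite (le_trans _ (expR_ge1Dxn k (normr_ge0 y)))// lerDr.
Qed.

Lemma series_exp_coeff_le (y : R) n : `|series (exp_coeff y) n| <= expR `|y|.
Proof.
rewrite /series/= (le_trans (ler_norm_sum _ _ _))//.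
rewrite (@le_trans _ _ (series (exp_coeff `|y|) n))//.
  rewrite /series/=; apply: ler_sum => k _.
  by rewrite /exp_coeff/= normrM normrX normfV (ger0_norm (ler0n _ _)).
apply: nondecreasing_cvgn_le; last exact: is_cvg_series_exp_coeff.
apply: nondecreasing_series => k _ _; exact: exp_coeff_ge0.
Qed.

Lemma integrable_gauss_weight q : 0 < q ->
  mu.-integrable D (EFin \o gauss_weight q).
Proof.
move=> q0; have h1 : forall s : R, 0 < s -> `|1 : R| <= expR `|2 * 0 * s|.
  by move=> s _; rewrite mulr0 mul0r normr0 expR0 normr1.
have ig := integrable_gauss_weight_le q0 (measurable_cst _) h1.
by apply: eq_integrable ig => // s _; rewrite /= mulr1.
Qed.

Lemma integral_gauss_weight q : 0 < q ->
  \int[mu]_(s in D) gauss_weight q s = euler_integral (q / 2) / 2.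
Proof.
move=> q0; have q2 : 0 < q / 2 by lra.
have ig := integrable_gauss_weight q0.
rewrite {1}/euler_integral /Rintegral.
have := integral_powR_gauss (q / 2); rewrite /euler_fun => ->.
rewrite [X in fine X / 2](_ : _ = (\int[mu]_(s in D) (2 * gauss_weight q s)%:E)%E).
  have e : \int[mu]_(s in D) (2 * gauss_weight q s) =
    2 * \int[mu]_(s in D) gauss_weight q s by exact: RintegralZl.
  by move: e; rewrite /Rintegral => ->; rewrite mulrC mulKf.
apply: eq_integral => s _; rewrite mulrC /gauss_weight.
by have -> : q / 2 *+ 2 = q by rewrite -mulr_natr divfK.
Qed.

Lemma integral_gauss_weight_exp_coeff q x k : 0 < q ->
  \int[mu]_(s in D) (gauss_weight q s * exp_coeff (- (2 * x * s)) k) =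
  exp_coeff (- (2 * x)) k * (euler_integral ((q + k%:R) / 2) / 2).
Proof.
move=> q0; have qk : 0 < q + k%:R by rewrite ltr_wpDr.
rewrite -integral_gauss_weight// -RintegralZl//.
- apply: eq_Rintegral => s; rewrite inE/= in_itv/= andbT => s0.
  have -> : gauss_weight (q + k%:R) s = gauss_weight q s * s ^+ k.
    rewrite /gauss_weight mulrAC -(@powR_mulrn _ s k (ltW s0)).
    rewrite -powRD ?(gt_eqF s0) ?implybT//; congr (_ `^ _ * _); ring.
  by rewrite /exp_coeff/= -mulNr exprMn; ring.
- exact: integrable_gauss_weight.
Qed.

Lemma pos_Rintegral_sum (f : nat -> R -> R) n :
  (forall k, mu.-integrable D (EFin \o f k)) ->
  mu.-integrable D (EFin \o (fun s => \sum_(0 <= k < n) f k s)) /\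
  \int[mu]_(s in D) (\sum_(0 <= k < n) f k s) =
  \sum_(0 <= k < n) \int[mu]_(s in D) f k s.
Proof.
move=> fi; elim: n => [|n [IHi IH]].
  rewrite big_geq//; split.
    apply: (@eq_integrable _ _ _ _ _ _ (cst 0%E)) => //; last exact: integrable0.
    by move=> s _ /=; rewrite big_geq.
  under eq_Rintegral do rewrite big_geq//.
  by rewrite Rintegral_cst ?mul0r.
have e : (fun s => \sum_(0 <= k < n.+1) f k s) =
    (fun s => \sum_(0 <= k < n) f k s + f n s).
  by apply/funext => s; rewrite big_nat_recr.
rewrite e; split; first exact: pos_integrableD.
by rewrite RintegralD// IH big_nat_recr.
Qed.

Lemma integral_gauss_weight_series q x n : 0 < q ->
  \int[mu]_(s in D) (gauss_weight q s * series (exp_coeff (- (2 * x * s))) n) =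
  series (fun k => exp_coeff (- (2 * x)) k *
    (euler_integral ((q + k%:R) / 2) / 2)) n.
Proof.
move=> q0; rewrite /series/=.
under eq_Rintegral do rewrite mulr_sumr.
rewrite (pos_Rintegral_sum _ _).2.
  by apply: eq_bigr => k _; exact: integral_gauss_weight_exp_coeff.
move=> k; apply: (@integrable_gauss_weight_le _ (- x)) => //.
- apply: pos_continuous_measurable => s _.
  apply: cvgMr_tmp.
  apply: (@continuous_comp _ _ _ (fun s : R => - (2 * x * s)) (fun y => y ^+ k)).
    by apply: cvgN; apply: cvgMl_tmp; exact: cvg_id.
  exact: exprn_continuous.
- move=> s _; rewrite (le_trans (exp_coeff_le_expR _ _))//.
  by rewrite mulrN mulNr.
Qed.

(** Source of the Kummer parameter 1/2, from the even terms of the exponential series; the odd terms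
    give 3/2 in [fact_doubleS]. *)
Lemma fact_double j : (j.*2)`!%:R = 4 ^+ j * j`!%:R * rising (1 / 2) j :> R.
Proof.
elim: j => [|j IH]; first by rewrite /rising big_ord0 expr0 !mulr1.
rewrite doubleS (factS j.*2.+1) (factS j.*2) (factS j) !natrM IH risingSr exprS.
rewrite -!natr1 -addnn natrD.
by field.
Qed.

Lemma fact_doubleS j : (j.*2.+1)`!%:R = 4 ^+ j * j`!%:R * rising (3 / 2) j :> R.
Proof.
elim: j => [|j IH]; first by rewrite /rising big_ord0 expr0 !mulr1.
have -> : (j.+1.*2.+1)`!%:R = j.*2.+3%:R * (j.*2.+2%:R * (j.*2.+1)`!%:R) :> R.
  by rewrite -!natrM doubleS.
have -> : (j.+1)`!%:R = j.+1%:R * j`!%:R :> R by rewrite -natrM.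
rewrite IH risingSr exprS.
rewrite -!natr1 -addnn natrD.
by field.
Qed.

Lemma series_double (f : R^nat) n :
  series f n.*2 = series (fun j => f j.*2 + f j.*2.+1) n.
Proof.
rewrite /series/=; elim: n => [|n IH]; first by rewrite !big_geq.
by rewrite doubleS !big_nat_recr//= IH addrA.
Qed.

(** Dominated convergence: the partial sums of exp(-2xs) never exceed exp|2xs|, which the Gaussian
    weight absorbs. *)
Lemma hermite_neg_cvg q x : 0 < q ->
  (fun n => \int[mu]_(s in D)
     (gauss_weight q s * series (exp_coeff (- (2 * x * s))) n)) @ \oo -->
  \int[mu]_(s in D) (gauss_weight q s * expR (- (2 * x * s))).
Proof.
move=> q0.
have mlin : measurable_fun D (fun s => - (2 * x * s)).
  apply: pos_continuous_measurable => s _.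
  by apply: cvgN; apply: cvgMl_tmp; exact: cvg_id.
have mser n : measurable_fun D (fun s => series (exp_coeff (- (2 * x * s))) n).
  rewrite /series/=; apply: measurable_sum => k.
  rewrite /exp_coeff/=; apply: measurable_funM; last exact: measurable_cst.
  apply: pos_continuous_measurable => s _.
  apply: (@continuous_comp _ _ _ (fun s : R => - (2 * x * s)) (fun y => y ^+ k)).
    by apply: cvgN; apply: cvgMl_tmp; exact: cvg_id.
  exact: exprn_continuous.
have mexp : measurable_fun D (fun s => expR (- (2 * x * s))).
  by apply: measurableT_comp => //; exact: measurable_expR.
have mE f : measurable_fun D f -> measurable_fun D (fun s => (gauss_weight q s * f s)%:E).
  move=> mf; apply/measurable_EFinP; apply: measurable_funM => //.
  exact: measurable_gauss_weight.
have mexp' : measurable_fun D (fun s => expR `|2 * x * s|).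
  apply: pos_continuous_measurable => s _.
  apply: (@continuous_comp _ _ _ (fun s : R => `|2 * x * s|) expR); last first.
    exact: continuous_expR.
  apply: (@continuous_comp _ _ _ (fun s : R => 2 * x * s) (fun y => `|y|)); last first.
    exact: norm_continuous.
  by apply: cvgMl_tmp; exact: cvg_id.
have ig := @integrable_gauss_weight_le q x _ q0 mexp'
   (fun s _ => ltac:(by rewrite ger0_norm// expR_ge0)).
pose f_ n s := (gauss_weight q s * series (exp_coeff (- (2 * x * s))) n)%:E.
pose f s := (gauss_weight q s * expR (- (2 * x * s)))%:E.
pose g s := (gauss_weight q s * expR `|2 * x * s|)%:E.
have cvf : {ae mu, forall s, D s -> f_ ^~ s @ \oo --> f s}.
  apply: aeW => s _; apply: cvg_EFin; first exact: nearW.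
  by apply: cvgMl_tmp; exact: is_cvg_series_exp_coeff.
have bf : {ae mu, forall s n, D s -> (`|f_ n s| <= g s)%E}.
  apply: aeW => s n _; rewrite lee_fin normrM (ger0_norm (gauss_weight_ge0 _ _)).
  rewrite ler_wpM2l ?gauss_weight_ge0//.
  by rewrite -[in leRHS]normrN series_exp_coeff_le.
have [ie _ cv] : [/\ mu.-integrable D f,
    (fun n => (\int[mu]_(s in D) `|f_ n s - f s|)%E) @ \oo --> 0%E &
    (fun n => (\int[mu]_(s in D) f_ n s)%E) @ \oo --> (\int[mu]_(s in D) f s)%E].
  apply: (@dominated_convergence _ _ _ mu D _ f_ f g) => //.
  - by move=> n; apply: mE.
  - exact: mE.
rewrite /Rintegral; apply: fine_cvg; rewrite fineK//.
exact: (integrable_fin_num _ ie).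
Qed.

Lemma hermite_integral q x : 0 < q ->
  hermite (- q) x =
  (\int[mu]_(s in D) (gauss_weight q s * expR (- (2 * x * s)))) / euler_integral q.
Proof.
move=> q0; have q2 : 0 < q / 2 by lra.
have q12 : 0 < (q + 1) / 2 by lra.
pose M1 := kummerM (q / 2) (1 / 2) (x ^+ 2).
pose M2 := kummerM ((q + 1) / 2) (3 / 2) (x ^+ 2).
have -> : \int[mu]_(s in D) (gauss_weight q s * expR (- (2 * x * s))) =
    euler_integral (q / 2) / 2 * M1 - x * euler_integral ((q + 1) / 2) * M2.
  have c := @hermite_neg_cvg q x q0.
  (* Only partial sums of even length are taken: the terms 2j and 2j + 1 together give the j-th
     terms of the two Kummer series. *)
  apply: (@eq_cvgn_unique _ (fun n => \int[mu]_(s in D)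
       (gauss_weight q s * series (exp_coeff (- (2 * x * s))) n.*2))
     (fun n => euler_integral (q / 2) / 2 * series (kummer_term (q / 2) (1 / 2) (x ^+ 2)) n
       - x * euler_integral ((q + 1) / 2)
         * series (kummer_term ((q + 1) / 2) (3 / 2) (x ^+ 2)) n)).
  - apply: (cvg_comp (fun n => n.*2) _ _ c).
    by apply/cvgnyPge => A; exists A => // n /= An; rewrite -addnn (leq_trans An)// leq_addr.
  - by apply: cvgB; apply: cvgMl_tmp; apply: kummerM_cvg; lra.
  - move=> n /=.
    have -> : \int[mu]_(s in D)
        (gauss_weight q s * series (exp_coeff (- (2 * x * s))) n.*2) =
      series (fun k => exp_coeff (- (2 * x)) k *
        (euler_integral ((q + k%:R) / 2) / 2)) n.*2.
      exact: integral_gauss_weight_series.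
    rewrite series_double /series/= !mulr_sumr -sumrB; apply: eq_bigr => j _.
    have -> : (q + (j.*2)%:R) / 2 = q / 2 + j%:R by rewrite -addnn natrD; field.
    have -> : (q + (j.*2.+1)%:R) / 2 = (q + 1) / 2 + j%:R.
      by rewrite -natr1 -addnn natrD; field.
    rewrite !euler_integral_rising//.
    move: (euler_integral (q / 2)) (euler_integral ((q + 1) / 2)) => E1 E2.
    rewrite /exp_coeff/= fact_double fact_doubleS /kummer_term.
    have k0 : j`!%:R != 0 :> R by rewrite pnatr_eq0 -lt0n fact_gt0.
    have r1 := @rising_gt0 _ (1 / 2 : R) j ltac:(lra).
    have r2 := @rising_gt0 _ (3 / 2 : R) j ltac:(lra).
    have -> : (- (2 * x)) ^+ j.*2 = 4 ^+ j * (x ^+ 2) ^+ j.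
      by rewrite -mul2n exprM sqrrN -exprMn; congr (_ ^+ _); ring.
    have -> : (- (2 * x)) ^+ j.*2.+1 = - (2 * x) * (4 ^+ j * (x ^+ 2) ^+ j).
      by rewrite exprS -mul2n exprM sqrrN -exprMn; congr (_ * _ ^+ _); ring.
    have f4 : (4 : R) ^+ j != 0 by rewrite expf_neq0.
    move: ((x ^+ 2) ^+ j) ((4 : R) ^+ j) f4 => X F F0.
    by field; rewrite F0 k0 !gt_eqF.
rewrite /hermite opprK.
rewrite [1 + q]addrC.
(* Duplication rewrites 2^(-q) sqrt(pi), so that one Gamma factor cancels in each of the two terms
   and 1/Gamma(q) comes out. *)
rewrite !Gamma_gt0E// euler_integral_duplication// -/M1 -/M2.
have := euler_integral_gt0 q0; have := euler_integral_gt0 q2.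
have := euler_integral_gt0 q12.
move: (euler_integral (q / 2)) (euler_integral ((q + 1) / 2)) (euler_integral q).
by move=> E1 E2 E3 E20 E10 E30; field; rewrite !gt_eqF.
Qed.
End HermiteIntegral.

(** * Comparison of the kernels *)

Section KernelEstimate.
Context {R : realType}.
Implicit Types (u m c s x X K theta : R).

(** Mean value theorem: the middle expression vanishes at 0 and has derivative y^2/(1 + y), which
    lies between 0 and u^2 on [0, u]. *)
Lemma ln1D_quadratic u : 0 <= u ->
  0 <= ln (1 + u) - u + u ^+ 2 / 2 <= u ^+ 3.
Proof.
rewrite le_eqVlt => /predU1P[<-|u0].
  by rewrite addr0 ln1 subr0 !expr0n/= mul0r addr0 lexx.
pose f y : R := ln (1 + y) - y + y ^+ 2 / 2.
pose f' y : R := (1 + y)^-1 - 1 + y.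
have df (y : R) : -1 < y -> is_derive y 1 f (f' y).
  move=> y1.
  have y0 : 0 < 1 + y by lra.
  have d1 : is_derive y 1 (fun y : R => 1 + y) (0 + 1) by exact: is_deriveD.
  have d2 := is_derive1_comp (is_derive1_ln y0) d1.
  have d3 := is_deriveM (is_derive_id y 1) (is_derive_id y 1).
  have d4 := is_deriveD (is_deriveB d2 (is_derive_id y 1))
    (is_deriveM d3 (is_derive_cst (2^-1 : R) y 1)).
  apply: is_derive_eq d4 _.
  by rewrite /f' /GRing.scale/=; field; rewrite gt_eqF.
have [] := @MVT R f f' 0 u u0.
- by move=> y; rewrite in_itv/= => /andP[y0 _]; apply: df; lra.
- apply: continuous_in_subspaceT => y; rewrite inE/= in_itv/= => /andP[y0 _].
  have [d _] := df y ltac:(lra).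
  exact/differentiable_continuous/derivable1_diffP.
move=> xi; rewrite in_itv/= => /andP[xi0 xiu].
rewrite {1}/f {1}/f addr0 ln1 expr0n/= mul0r !subr0 addr0 subr0 -/(f u) => ->.
have -> : f' xi = xi ^+ 2 / (1 + xi) by rewrite /f'; field; rewrite gt_eqF//; lra.
have q0 : 0 <= xi ^+ 2 / (1 + xi) by rewrite divr_ge0 ?sqr_ge0//; lra.
have q1 : xi ^+ 2 / (1 + xi) <= u ^+ 2.
  rewrite ler_pdivrMr; last lra.
  have := sqr_ge0 u; rewrite !expr2 => uu; nra.
rewrite (mulr_ge0 q0 (ltW u0))/= [u ^+ 3]exprSr.
exact: ler_wpM2r (ltW u0) _ _ q1.
Qed.

(** The tangent at m lies above the concave logarithm; its value ln(1 + m) there is relaxed to m. *)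
Lemma ln1D_tangent u m : 0 <= u -> 0 <= m -> ln (1 + u) <= m + (u - m) / (1 + m).
Proof.
move=> u0 m0; have m1 : 0 < 1 + m by lra.
have -> : 1 + u = (1 + m) * (1 + (u - m) / (1 + m)) by field; rewrite gt_eqF.
have h : 0 < 1 + (u - m) / (1 + m).
  have -> : 1 + (u - m) / (1 + m) = (1 + u) / (1 + m) by field; rewrite gt_eqF.
  by rewrite divr_gt0//; lra.
rewrite lnM ?posrE// lerD//; first by apply: le_ln1Dx; lra.
by apply: le_ln1Dx; lra.
Qed.

Lemma expRB_norm_le (p q l : R) : p <= l -> q <= l ->
  `|expR p - expR q| <= `|p - q| * expR l.
Proof.
have key (y z : R) : expR y - expR z <= (y - z) * expR y.
  have := expR_ge1Dx (z - y); rewrite expRD expRN => h.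
  have y0 := expR_gt0 y.
  have := ler_wpM2r (ltW y0) h; rewrite divfK ?gt_eqF//; lra.
wlog pq : p q / q <= p => [hw pl ql|pl ql].
  have [|/ltW] := leP q p; first by move=> h; exact: hw.
  by rewrite distrC [`|p - q|]distrC => h; exact: hw.
rewrite !ger0_norm ?subr_ge0 ?ler_expR//.
rewrite (le_trans (key p q))// ler_wpM2l ?subr_ge0 ?ler_expR//.
Qed.

(** Both exponents have the common upper bound 2 K^2 - s, with K = 2X + 2, so the difference of the
    exponentials is at most the difference of the exponents times e^(2 K^2 - s). The number theta is
    the rounding of the ceiling. *)
Lemma kernel_estimate c x X theta (n : nat) s : `|x| <= X -> 4 * X + 4 <= c ->
  0 <= theta <= 1 -> n%:R = c ^+ 2 / 2 - x * c + theta -> 0 < s ->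
  `|expR (- (c * s)) * (1 + 2 * s / c) ^+ n| <=
    expR (2 * (2 * X + 2) ^+ 2) * expR (- s) /\
  `|expR (- (c * s)) * (1 + 2 * s / c) ^+ n - expR (- s ^+ 2 - 2 * x * s)| <=
    (4 + 2 * X) / c * (1 + s) ^+ 3 * (expR (2 * (2 * X + 2) ^+ 2) * expR (- s)).
Proof.
move=> xX Xc /andP[th0 th1] nE s0.
have X0 : 0 <= X by rewrite (le_trans _ xX).
have c0 : 0 < c by lra.
(* The quadratic part of the exponent supplies -K s, the part with theta - x c costs at most (2X +
   1) s, and K is chosen to leave -s. *)
set K := 2 * X + 2; set u := 2 * s / c.
have u0 : 0 < u by rewrite /u divr_gt0// mulr_gt0.
have uc : u * c = 2 * s by rewrite /u divfK// gt_eqF.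
set L := ln (1 + u).
have -> : expR (- (c * s)) * (1 + u) ^+ n = expR (n%:R * L - c * s).
  by rewrite expRD mulrC expRM_natl /L lnK ?posrE//; lra.
have [xl xr] : - X <= x /\ x <= X by apply/andP; rewrite -ler_norml.
have L0 : 0 <= L by rewrite /L ln_ge0//; lra.
have Lu : L <= u by apply: le_ln1Dx; lra.
have us : u <= s.
  by rewrite /u ler_pdivrMr// mulrC ler_pM2l//; lra.
have bf : n%:R * L - c * s <= 2 * K ^+ 2 - s.
  (* Bound [ln] by its tangent at [1 + m], where [m] is the value of [u] at [s = K]. *)
  pose m := 2 * K / c.
  have K0 : 0 < K by rewrite /K; lra.
  have m0 : 0 < m by rewrite /m divr_gt0// mulr_gt0.
  have m1 : m <= 1 by rewrite /m ler_pdivrMr// mul1r /K; lra.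
  have mc : m * c = 2 * K by rewrite /m divfK// gt_eqF.
  have t1 := ln1D_tangent (ltW u0) (ltW m0); rewrite -/L in t1.
  have t2 : c ^+ 2 / 2 * (L - u) <= 2 * K ^+ 2 - K * s.
    have -> : 2 * K ^+ 2 - K * s = c ^+ 2 / 2 * (m ^+ 2 - m * u / 2).
      have -> : c ^+ 2 / 2 * (m ^+ 2 - m * u / 2) =
        (m * c) ^+ 2 / 2 - (m * c) * (u * c) / 4 by field.
      by rewrite mc uc; field.
    rewrite ler_wpM2l ?divr_ge0 ?sqr_ge0//.
    have e : m + (u - m) / (1 + m) - u = - ((u - m) * m / (1 + m)).
      by field; rewrite gt_eqF//; lra.
    have t3 : - ((u - m) * m / (1 + m)) <= m ^+ 2 - m * u / 2.
      rewrite -mulNr -mulNr ler_pdivrMr; last lra.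
      rewrite -subr_ge0.
      have -> : (m ^+ 2 - m * u / 2) * (1 + m) - - (u - m) * m =
        m * u * (1 - m) / 2 + m ^+ 3 by field.
      rewrite addr_ge0//; last by rewrite exprn_ge0// ltW.
      have m1' : 0 <= 1 - m by rewrite subr_ge0.
      by rewrite divr_ge0//; exact: mulr_ge0 (mulr_ge0 (ltW m0) (ltW u0)) m1'.
    lra.
  have t4 : n%:R * L - c * s = c ^+ 2 / 2 * (L - u) + (theta - x * c) * L.
    have -> : c * s = c ^+ 2 / 2 * u.
      by transitivity (c * (u * c) / 2); [rewrite uc|]; field.
    by rewrite nE; ring.
  have t5 : (theta - x * c) * L <= (2 * X + 1) * s.
    have : (theta - x * c) * L <= (1 + X * c) * u.
      have : (theta - x * c) * L <= (1 + X * c) * L by apply: ler_wpM2r => //; nra.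
      have : (1 + X * c) * L <= (1 + X * c) * u by apply: ler_wpM2l => //; nra.
      lra.
    have -> : (1 + X * c) * u = u + X * (2 * s) by rewrite -uc; ring.
    lra.
  by rewrite t4 /K; rewrite /K in t2; lra.
have bg : - s ^+ 2 - 2 * x * s <= 2 * K ^+ 2 - s.
  have := sqr_ge0 (s - (2 * X + 1) / 2); rewrite /K !expr2.
  have : - x * s <= X * s by rewrite ler_pM2r//; lra.
  have : 0 <= X * X by rewrite mulr_ge0.
  lra.
have eb : expR (2 * K ^+ 2) * expR (- s) = expR (2 * K ^+ 2 - s) by rewrite expRD.
rewrite eb; split; first by rewrite ger0_norm ?expR_ge0// ler_expR.
rewrite (le_trans (expRB_norm_le bf bg))// ler_wpM2r ?expR_ge0//.
have -> : n%:R * L - c * s - (- s ^+ 2 - 2 * x * s) =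
    c ^+ 2 / 2 * (L - u + u ^+ 2 / 2) - x * c * (L - u) + theta * L.
  have sE : s = u * c / 2 by rewrite uc; field.
  by rewrite nE {1 2 3}sE; field.
have /andP[q0 q1] := ln1D_quadratic (ltW u0); rewrite -/L in q0 q1.
(* The three remainders are at most 4 s^3/c, 2 X s^2/c and 2 s/c; the last summand is the slack up
   to the stated bound. *)
have cP : (4 + 2 * X) / c * (1 + s) ^+ 3 =
    c ^+ 2 / 2 * u ^+ 3 + X * c * (u ^+ 2 / 2) + u
    + ((4 + 2 * X) * (1 + s) ^+ 3 - 4 * s ^+ 3 - 2 * X * s ^+ 2 - 2 * s) / c.
  by rewrite /u; field; rewrite gt_eqF.
have rest : 0 <= ((4 + 2 * X) * (1 + s) ^+ 3 - 4 * s ^+ 3 - 2 * X * s ^+ 2 - 2 * s) / c.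
  rewrite divr_ge0 ?(ltW c0)//.
  have -> : (4 + 2 * X) * (1 + s) ^+ 3 - 4 * s ^+ 3 - 2 * X * s ^+ 2 - 2 * s =
    4 + 10 * s + 12 * s ^+ 2 + X * (2 + 6 * s + 4 * s ^+ 2 + 2 * s ^+ 3) by ring.
  by rewrite !(addr_ge0, mulr_ge0, exprn_ge0)// ltW.
rewrite cP ler_wpDr//.
rewrite (le_trans (ler_normD _ _))// lerD//; last first.
  by rewrite ger0_norm ?mulr_ge0// -[leRHS]mul1r ler_pM.
rewrite (le_trans (ler_normB _ _))// lerD//.
  have cc : 0 <= c ^+ 2 / 2 by rewrite divr_ge0 ?sqr_ge0.
  by rewrite (ger0_norm (mulr_ge0 cc q0)); exact: ler_wpM2l cc _ _ q1.
rewrite !normrM (gtr0_norm c0) ler_pM ?mulr_ge0 ?(ltW c0)//.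
  by rewrite ler_pM2r.
by rewrite ler0_norm; lra.
Qed.

End KernelEstimate.

(** * Integral representation of the Charlier polynomials *)

Section CharlierIntegral.
Context {R : realType}.
Notation mu := (@lebesgue_measure R).
Notation D := (`]0%R, +oo[%classic : set R).
Implicit Types (a q x s t : R).

(** At -q the signs of the falling factorial cancel those of (-a)^(-k), and the sum becomes the
    binomial expansion of (1 + t/a)^n integrated term by term. *)
Lemma charlier_integral a n q : 0 < a -> 0 < q ->
  charlier a n (- q) =
  (\int[mu]_(t in D) (euler_fun q t * (1 + t / a) ^+ n)) / euler_integral q.
Proof.
move=> a0 q0; pose w k : R := 'C(n, k)%:R * a ^- k.
have expand t : 0 < t -> euler_fun q t * (1 + t / a) ^+ n =
    \sum_(0 <= k < n.+1) w k * euler_fun (q + k%:R) t.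
  move=> t0; rewrite exprDn mulr_sumr big_mkord; apply: eq_bigr => k _.
  have -> : euler_fun (q + k%:R) t = euler_fun q t * t ^+ k.
    rewrite /euler_fun mulrAC -(@powR_mulrn _ t k (ltW t0)).
    by rewrite -powRD ?(gt_eqF t0) ?implybT//; congr (_ `^ _ * _); ring.
  rewrite expr1n mul1r expr_div_n -mulr_natr /w.
  by move: (euler_fun q t) (a ^+ k)^-1 (t ^+ k) => A B C; ring.
have qk k : 0 < q + k%:R by rewrite ltr_wpDr.
have ik k : mu.-integrable D (EFin \o (fun t => w k * euler_fun (q + k%:R) t)).
  by apply: pos_integrableZ; exact: integrable_euler_fun.
have -> : \int[mu]_(t in D) (euler_fun q t * (1 + t / a) ^+ n) =
    \sum_(0 <= k < n.+1) w k * euler_integral (q + k%:R).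
  transitivity (\int[mu]_(t in D)
      (\sum_(0 <= k < n.+1) w k * euler_fun (q + k%:R) t)).
    by apply: eq_Rintegral => t; rewrite inE/= in_itv/= andbT => /expand.
  rewrite (pos_Rintegral_sum _ ik).2; apply: eq_bigr => k _.
  by rewrite RintegralZl//; exact: integrable_euler_fun.
rewrite charlierE big_mkord mulr_suml; apply: eq_bigr => k _.
rewrite euler_integral_rising// -[RHS]mulrA mulfK; last first.
  by rewrite gt_eqF// euler_integral_gt0.
rewrite falling_opp /w -[- a]mulN1r exprMn invfM.
have s1 : ((-1) ^+ k)^-1 * (-1) ^+ k = 1 :> R by rewrite mulVf// signr_eq0.
have -> : 'C(n, k)%:R * (((-1) ^+ k)^-1 * a ^- k) * ((-1) ^+ k * rising q k) =
  'C(n, k)%:R * a ^- k * rising q k * (((-1) ^+ k)^-1 * (-1) ^+ k) :> R by ring.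
by rewrite s1 mulr1.
Qed.

(* [t = c s] with [c = sqrt (2 a)], so that [t / a = 2 s / c]. *)
Definition charlier_kernel (c : R) (n : nat) s : R :=
  expR (- (c * s)) * (1 + 2 * s / c) ^+ n.

Lemma continuous_charlier_kernel c n s : {for s, continuous (charlier_kernel c n)}.
Proof.
apply: cvgM.
  apply: (@continuous_comp _ _ _ (fun s : R => - (c * s)) expR).
    by apply: cvgN; apply: cvgMl_tmp; exact: cvg_id.
  exact: continuous_expR.
apply: (@continuous_comp _ _ _ (fun s : R => 1 + 2 * s / c) (fun y => y ^+ n)).
  apply: cvgD; first exact: cvg_cst.
  by apply: cvgMr_tmp; apply: cvgMl_tmp; exact: cvg_id.
exact: exprn_continuous.
Qed.

Lemma scaled_charlier_integral a n q : 0 < a -> 0 < q ->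
  mu.-integrable D
    (EFin \o (fun s => s `^ (q - 1) * charlier_kernel (Num.sqrt (2 * a)) n s)) ->
  (2 * a) `^ (- q / 2) * charlier a n (- q) =
  (\int[mu]_(s in D) (s `^ (q - 1) * charlier_kernel (Num.sqrt (2 * a)) n s))
    / euler_integral q.
Proof.
move=> a0 q0; set c := Num.sqrt (2 * a) => ik.
have a20 : 0 < 2 * a by rewrite mulr_gt0.
have c0 : 0 < c by rewrite sqrtr_gt0.
have c2 : c ^+ 2 = 2 * a by rewrite sqr_sqrtr// ltW.
have cq0 : 0 < c `^ q by rewrite powR_gt0.
have -> : (2 * a) `^ (- q / 2) = (c `^ q)^-1.
  rewrite -powRN -c2 -powR_mulrn ?(ltW c0)// -powRrM.
  by congr (_ `^ _); field.
rewrite charlier_integral// mulrA; congr (_ / _).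
suff -> : \int[mu]_(t in D) (euler_fun q t * (1 + t / a) ^+ n) =
  c `^ q * \int[mu]_(s in D) (s `^ (q - 1) * charlier_kernel c n s).
  by rewrite mulKf// gt_eqF.
rewrite -RintegralZl// /Rintegral; congr fine.
transitivity (\int[mu]_(s in D)
    (euler_fun q (c * s) * (1 + c * s / a) ^+ n * c)%:E)%E.
  apply: (@pos_substitution _ (fun s => c * s) (fun=> c)
    (fun t => euler_fun q t * (1 + t / a) ^+ n)).
  - by move=> x y _ _ xy; rewrite ltr_pM2l.
  - by move=> x x0; rewrite mulr_gt0.
  - move=> x _; have := is_deriveZ c (is_derive_id x 1).
    by rewrite /GRing.scale/= mulr1.
  - by move=> x _; exact: cvg_cst.
  - by move=> x _; exact: ltW.
  - rewrite -[X in _ --> X](mulr0 c); apply: cvgMl_tmp.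
    by apply: cvg_at_right_filter; exact: cvg_id.
  - by apply: gt0_cvgMry => //; exact: cvg_id.
  - move=> x x0; apply: cvgM; first exact: continuous_euler_fun.
    apply: (@continuous_comp _ _ _ (fun s : R => 1 + s / a) (fun y => y ^+ n)).
      apply: cvgD; first exact: cvg_cst.
      by apply: cvgMr_tmp; exact: cvg_id.
    exact: exprn_continuous.
  - move=> x x0; rewrite mulr_ge0 ?euler_fun_ge0// exprn_ge0//.
    by rewrite addr_ge0// divr_ge0 ?ltW.
apply: eq_integral => s; rewrite inE/= in_itv/= andbT => s0; congr EFin.
have -> : c * s / a = 2 * s / c.
  have -> : a = c ^+ 2 / 2 by rewrite c2; field.
  by field; rewrite gt_eqF.
rewrite /euler_fun /charlier_kernel powRM ?(ltW c0) ?(ltW s0)//.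
have -> : c `^ q = c * c `^ (q - 1) by rewrite mulr_powRB1// ltW.
by move: (c `^ (q - 1)) (s `^ (q - 1)) (expR _) (_ ^+ n) => A B C E; ring.
Qed.

End CharlierIntegral.

(** * The error estimate *)

Section Recurrences.
Context {R : realType}.
Implicit Types (a x y nu : R).

(** By [invGamma_rec] only 1/Gamma(1 - nu/2) and 1/Gamma((1 - nu)/2) remain. Their coefficients
    agree by [kummerM_contig_z] for the first and [kummerM_contig] for the second. *)
Lemma hermite_rec nu x :
  hermite (nu + 1) x = 2 * x * hermite nu x - 2 * nu * hermite (nu - 1) x.
Proof.
have half2 : 1 / 2 <= 1 / 2 :> R by [].
have e32 : 1 / 2 + 1 = 3 / 2 :> R by field.
have p1 : (2 : R) `^ (nu + 1) = 2 * 2 `^ nu.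
  by rewrite powRD ?pnatr_eq0 ?implybT// powRr1// mulrC.
have pm : (2 : R) `^ (nu - 1) = 2 `^ nu / 2.
  by rewrite powRB ?pnatr_eq0 ?implybT// powRr1.
rewrite /hermite p1 pm.
have -> : (1 - (nu + 1)) / 2 = - nu / 2 by field.
have -> : - (nu + 1) / 2 = (1 - nu) / 2 - 1 by field.
have -> : (1 - (nu - 1)) / 2 = - nu / 2 + 1 by field.
have -> : - (nu - 1) / 2 = (1 - nu) / 2 by field.
have k1 := kummerM_contig_z ((1 - nu) / 2) (x ^+ 2) half2.
have k2 := kummerM_contig (- nu / 2) (x ^+ 2) half2.
rewrite e32 in k1 k2.
have g1 := invGamma_rec (- nu / 2).
have := invGamma_rec ((1 - nu) / 2 - 1); rewrite subrK => g2.
rewrite g2 g1.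
move: k1 k2 {g1 g2}.
move: (kummerM ((1 - nu) / 2) (1 / 2) (x ^+ 2)) (kummerM ((1 - nu) / 2 - 1) (1 / 2) (x ^+ 2))
  (kummerM ((1 - nu) / 2) (3 / 2) (x ^+ 2)) (kummerM (- nu / 2 + 1) (3 / 2) (x ^+ 2))
  (kummerM (- nu / 2) (3 / 2) (x ^+ 2)) (kummerM (- nu / 2) (1 / 2) (x ^+ 2))
  (Gamma (- nu / 2 + 1))^-1 (Gamma ((1 - nu) / 2))^-1 (2 `^ nu) (Num.sqrt pi)
  => M1 M2 M3 M4 M5 M6 A B P S k1 k2.
have -> : M2 = M1 - 2 * x ^+ 2 * M3 by lra.
have -> : M6 = - nu * M4 + (1 + nu) * M5 by lra.
by field.
Qed.

(** The degree [charlier_index a x] does not involve nu, so [charlier_rec] applies at fixed n; the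
    middle coefficient is arranged to tend to 2x. *)
Lemma scaled_charlier_rec a y x : 0 < a ->
  scaled_charlier a (y + 1) x =
  Num.sqrt (2 * a) / a * (y + a - `|charlier_index a x|%N%:R) * scaled_charlier a y x
  - 2 * y * scaled_charlier a (y - 1) x.
Proof.
move=> a0; rewrite /scaled_charlier; set n := `|_|%N.
have a20 : 0 < 2 * a by rewrite mulr_gt0.
have rec := charlier_rec n y (lt0r_neq0 a0).
have -> : charlier a n (y + 1) =
    ((y + a - n%:R) * charlier a n y - y * charlier a n (y - 1)) / a.
  by rewrite -rec mulrC mulKf// gt_eqF.
have p1 : (2 * a) `^ ((y + 1) / 2) = (2 * a) `^ (y / 2) * Num.sqrt (2 * a).
  rewrite -powR12_sqrt ?(ltW a20)// -powRD ?(gt_eqF a20) ?implybT//.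
  by congr (_ `^ _); field.
have p2 : (2 * a) `^ ((y + 1) / 2) = (2 * a) `^ ((y - 1) / 2) * (2 * a).
  rewrite -[X in _ = _ * X](powRr1 (ltW a20)) -powRD ?(gt_eqF a20) ?implybT//.
  by congr (_ `^ _); field.
rewrite mulrBl mulrBr {1}p1 p2.
by field; rewrite gt_eqF.
Qed.

(** With c = sqrt(2a), 4X <= c gives x c <= c^2/4 = a/2, so the ceiling is nonnegative and taking
    its absolute value changes nothing. *)
Lemma charlier_index_spec a x X : `|x| <= X -> 4 * X <= Num.sqrt (2 * a) -> 0 < a ->
  0 <= charlier_index a x /\
  exists2 theta : R, 0 <= theta <= 1 &
    `|charlier_index a x|%N%:R = a - x * Num.sqrt (2 * a) + theta.
Proof.
move=> xX Xc a0; have X0 : 0 <= X by rewrite (le_trans _ xX).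
set c := Num.sqrt (2 * a) in Xc *.
have c0 : 0 <= c by rewrite sqrtr_ge0.
have c2 : c ^+ 2 = 2 * a by rewrite sqr_sqrtr// mulr_ge0// ltW.
have [xl xr] : - X <= x /\ x <= X by apply/andP; rewrite -ler_norml.
have y0 : 0 <= a - x * c.
  have h1 : x * c <= X * c by apply: ler_wpM2r.
  have h2 : 4 * X * c <= c * c by apply: ler_wpM2r.
  rewrite expr2 in c2.
  have h3 : 0 <= X * c by rewrite mulr_ge0.
  lra.
have i0 : 0 <= charlier_index a x by rewrite /charlier_index ceil_ge0 -/c; lra.
split => //; exists ((charlier_index a x)%:~R - (a - x * c)).
  have := ceil_itv (a - x * c); rewrite -/(charlier_index a x) intrB.
  by move=> /andP[h1 h2]; apply/andP; split; lra.
by rewrite natr_absz ger0_norm// addrC subrK.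
Qed.

End Recurrences.

Section Estimate.
Context {R : realType}.
Notation mu := (@lebesgue_measure R).
Notation D := (`]0%R, +oo[%classic : set R).
Implicit Types (a q x nu X : R).

Lemma euler_integral_nat_ge1 k : 1 <= euler_integral (k.+1%:R : R).
Proof.
elim: k => [|k IH]; first by rewrite euler_integral_1.
by rewrite -natr1 euler_integral_rec// mulr_ege1// ler1n.
Qed.

(** Shifting up to the next integer k + 1 gives 1 <= Gamma(k+1) <= q^s Gamma(q) <= q Gamma(q).
    Crude, but uniform on bounded ranges of q. *)
Lemma inv_euler_integral_le q : 1 <= q -> (euler_integral q)^-1 <= q.
Proof.
move=> q1; have q0 : 0 < q by rewrite (lt_le_trans _ q1).
pose k := Num.truncn q; have /andP[kq qk] := truncn_itv (ltW q0).
rewrite -/k in kq qk.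
pose s := k.+1%:R - q.
have s01 : 0 <= s <= 1.
  by rewrite /s -natr1; rewrite -natr1 in qk; apply/andP; split; lra.
have := euler_integral_shift_le q0 s01; rewrite /s subrKC -/s.
have := euler_integral_nat_ge1 k; have := euler_integral_gt0 q0.
move: (euler_integral q) (euler_integral k.+1%:R) => E Ek E0 Ek1 h.
have p : q `^ s <= q.
  by rewrite -[leRHS](powRr1 (ltW q0)) ler_powR//; case/andP: s01.
rewrite -[leLHS]mul1r ler_pdivrMr// (le_trans Ek1)// (le_trans h)//.
by rewrite ler_pM2r.
Qed.

Lemma Rintegral_le_norm (f g : R -> R) :
  measurable_fun D f -> mu.-integrable D (EFin \o g) ->
  (forall s, 0 < s -> `|f s| <= g s) ->
  mu.-integrable D (EFin \o f) /\
  `|\int[mu]_(s in D) f s| <= \int[mu]_(s in D) g s.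
Proof.
move=> mf ig fg.
have ifn : mu.-integrable D (EFin \o f).
  apply: (le_integrable _ _ _ ig) => //; first exact/measurable_EFinP.
  move=> s/=; rewrite in_itv/= andbT => s0; rewrite lee_fin.
  by rewrite (le_trans (fg _ s0))// ler_norm.
split => //; rewrite (le_trans (le_normr_Rintegral _ _))//.
apply: le_Rintegral => //.
- exact: integrable_norm.
- by move=> s /=; rewrite in_itv/= andbT => /fg.
Qed.

Lemma scaled_charlier_estimate_neg (N : nat) X : 0 <= X ->
  exists C : R, 0 < C /\ forall a nu x, (4 * X + 4) ^+ 2 <= 2 * a ->
    - N.+1%:R <= nu <= -1 -> `|x| <= X ->
    `|scaled_charlier a nu x| <= C /\
    `|scaled_charlier a nu x - hermite nu x| <= C / Num.sqrt a.
Proof.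
move=> X0.
pose B := expR (2 * (2 * X + 2) ^+ 2).
pose G (s : R) := expR (- (s / 2)).
have iG : mu.-integrable D (EFin \o G).
  apply: (@integrable_expR_decay _ _ 1) => [|t _].
    apply: pos_continuous_measurable => t _.
    apply: (@continuous_comp _ _ _ (fun s : R => - (s / 2)) expR).
      by apply: cvgN; apply: cvgMr_tmp; exact: cvg_id.
    exact: continuous_expR.
  by rewrite mul1r ger0_norm ?expR_ge0.
pose I := \int[mu]_(s in D) G s.
have I0 : 0 <= I by apply: Rintegral_ge0 => s _; exact: expR_ge0.
(* Exponent N + 3: s^(q-1) <= (1 + s)^N, and the kernel difference brings (1 + s)^3. *)
pose A := 2 ^+ (N + 3) * (N + 3)`!%:R * expR (1 / 2) : R.
have A0 : 0 < A by rewrite !mulr_gt0 ?expR_gt0 ?exprn_gt0// ltr0n fact_gt0.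
have B0 : 0 < B by exact: expR_gt0.
pose C0 := (4 + 2 * X) * (A * B).
have C00 : 0 < C0 by rewrite !mulr_gt0//; lra.
have CI0 : 0 <= N.+1%:R * (C0 * I).
  by apply: mulr_ge0 => //; exact: mulr_ge0 (ltW C00) I0.
(* The factor N + 1 bounds 1/Gamma(q) through q <= N + 1; adding 1 makes the constant positive, as I
   is only known to be nonnegative. *)
exists (N.+1%:R * (C0 * I) + 1); split; first exact: ltr_wpDl.
move=> a nu x Xa; rewrite -[nu]opprK; move: (- nu) => q /andP[q2 q1] xX.
have {q1} q1 : 1 <= q by lra.
have {q2} qN : q - 1 <= N%:R by rewrite -natr1 in q2; lra.
have q0 : 0 < q by lra.
have a0 : 0 < a by have := sqr_ge0 (4 * X + 4); nra.
have Xc : 4 * X + 4 <= Num.sqrt (2 * a).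
  rewrite -(@ger0_norm _ (4 * X + 4)); last lra.
  by rewrite -sqrtr_sqr ler_wsqrtr.
have [_ [theta th nE]] := @charlier_index_spec _ a x X xX ltac:(lra) a0.
rewrite /scaled_charlier; set n := `|_|%N in nE *.
set c := Num.sqrt (2 * a) in Xc nE *.
have c0 : 0 < c by lra.
have c2 : c ^+ 2 = 2 * a by rewrite sqr_sqrtr// mulr_ge0// ltW.
have nE' : n%:R = c ^+ 2 / 2 - x * c + theta by rewrite nE c2; field.
have ker s s0 := @kernel_estimate _ c x X theta n s xX Xc th nE' s0.
have pw s : 0 < s -> s `^ (q - 1) <= (1 + s) ^+ N.
  by move=> s0; apply: powR_le_1D => //; rewrite qN andbT; lra.
have poly k s : (k <= 3)%N -> 0 < s ->
    (1 + s) ^+ N * (1 + s) ^+ k * expR (- s) <= A * G s.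
  move=> k3 s0; have s1 : 1 <= 1 + s by lra.
  rewrite -exprD (@le_trans _ _ ((1 + s) ^+ (N + 3) * expR (- s)))//.
    by rewrite ler_wpM2r ?expR_ge0// ler_weXn2l// leq_add2l.
  have := ler_wpM2r (expR_ge0 (- s)) (exprn_1D_le_expR (N + 3) s0).
  move/le_trans; apply; rewrite -[X in X <= _]mulrA -expRD /G.
  by rewrite le_eqVlt; apply/orP; left; apply/eqP; congr (_ * expR _); field.
have mp : measurable_fun D (fun s : R => s `^ (q - 1)).
  by apply: measurable_funTS; exact: measurable_powR.
have mk : measurable_fun D (charlier_kernel c n).
  by apply: pos_continuous_measurable => s _; exact: continuous_charlier_kernel.
have mg : measurable_fun D (fun s : R => expR (- s ^+ 2 - 2 * x * s)).
  apply: pos_continuous_measurable => s _.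
  apply: (@continuous_comp _ _ _ (fun s : R => - s ^+ 2 - 2 * x * s) expR).
    apply: cvgB; first by apply: cvgN; exact: exprn_continuous.
    by apply: cvgMl_tmp; exact: cvg_id.
  exact: continuous_expR.
have iCG (r : R) : mu.-integrable D (EFin \o (fun s => r * G s)).
  exact: pos_integrableZ.
have [ik bk] : mu.-integrable D
      (EFin \o (fun s => s `^ (q - 1) * charlier_kernel c n s)) /\
    `|\int[mu]_(s in D) (s `^ (q - 1) * charlier_kernel c n s)| <=
      \int[mu]_(s in D) (C0 * G s).
  apply: Rintegral_le_norm => //; first exact: measurable_funM.
  move=> s s0; have [k1 _] := ker s s0.
  rewrite normrM ger0_norm ?powR_ge0//.
  apply: (@le_trans _ _ ((1 + s) ^+ N * (B * expR (- s)))).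
    by apply: ler_pM => //; [exact: powR_ge0|exact: pw].
  apply: (@le_trans _ _ (B * (A * G s))).
    have := poly 0%N s isT s0; rewrite expr0 mulr1 => h.
    by rewrite mulrCA ler_wpM2l// ltW.
  rewrite mulrA /C0 [B * A]mulrC ler_wpM2r ?expR_ge0// ler_peMl//; last lra.
  by rewrite mulr_ge0// ltW.
have [idf bd] : mu.-integrable D
      (EFin \o (fun s => s `^ (q - 1) *
        (charlier_kernel c n s - expR (- s ^+ 2 - 2 * x * s)))) /\
    `|\int[mu]_(s in D) (s `^ (q - 1) *
        (charlier_kernel c n s - expR (- s ^+ 2 - 2 * x * s)))| <=
      \int[mu]_(s in D) (C0 / c * G s).
  apply: Rintegral_le_norm => //.
    by apply: measurable_funM => //; exact: measurable_funB.
  move=> s s0; have [_ k2] := ker s s0.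
  rewrite normrM ger0_norm ?powR_ge0//.
  apply: (@le_trans _ _ ((1 + s) ^+ N *
      ((4 + 2 * X) / c * (1 + s) ^+ 3 * (B * expR (- s))))).
    by apply: ler_pM => //; [exact: powR_ge0|exact: pw].
  have := poly 3%N s isT s0 => h.
  have r0 : 0 <= (4 + 2 * X) / c * B.
    by rewrite mulr_ge0 ?divr_ge0 ?(ltW c0) ?(ltW B0)//; lra.
  have := ler_wpM2l r0 h; rewrite /C0.
  apply: etrans; congr (_ <= _); first by ring.
  by field; rewrite gt_eqF.
have -> : hermite (- q) x = (\int[mu]_(s in D)
    (s `^ (q - 1) * expR (- s ^+ 2 - 2 * x * s))) / euler_integral q.
  rewrite (hermite_integral x q0).
  by under eq_Rintegral do rewrite /gauss_weight -mulrA -expRD.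
rewrite (scaled_charlier_integral a0 q0 ik) -/c.
have Einv := inv_euler_integral_le q1.
have E0 := euler_integral_gt0 q0.
rewrite -mulrBl !normrM normfV (gtr0_norm E0).
have qN1 : q <= N.+1%:R by rewrite -natr1; lra.
move: {E0} (ltW E0) Einv; rewrite -invr_ge0.
move: (euler_integral q)^-1 => Ei Ei0 Eiq.
have EiN : Ei <= N.+1%:R by exact: le_trans qN1.
have ig : mu.-integrable D
    (EFin \o (fun s => s `^ (q - 1) * expR (- s ^+ 2 - 2 * x * s))).
  have := pos_integrableB ik idf.
  by apply: eq_integrable => // s _ /=; congr EFin; ring.
split.
  rewrite (@le_trans _ _ (N.+1%:R * (C0 * I)))// ?lerDl//.
  rewrite mulrC ler_pM// (le_trans bk)// RintegralZl//.
rewrite -RintegralB//.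
under eq_Rintegral do rewrite -mulrBr.
rewrite RintegralZl// -/I in bd.
have sa0 : 0 < Num.sqrt a by rewrite sqrtr_gt0.
have ca : Num.sqrt a <= c by rewrite ler_wsqrtr//; lra.
apply: (@le_trans _ _ (N.+1%:R * (C0 / c * I))).
  by rewrite mulrC ler_pM.
rewrite mulrDl; apply: ler_wpDr; first by rewrite divr_ge0// ltW.
rewrite -[leRHS]mulrA ler_wpM2l//.
rewrite mulrAC ler_wpM2l//; first by rewrite mulr_ge0// ltW.
by rewrite lef_pV2 ?posrE.
Qed.

Lemma scaled_charlier_estimate (m N : nat) X : 0 <= X ->
  exists C : R, 0 < C /\ forall a nu x, (4 * X + 4) ^+ 2 <= 2 * a ->
    - N.+1%:R <= nu <= m%:R - 1 -> `|x| <= X ->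
    `|scaled_charlier a nu x| <= C /\
    `|scaled_charlier a nu x - hermite nu x| <= C / Num.sqrt a.
Proof.
move=> X0; elim: m N => [|m IH] N.
  have [C [C0 h]] := scaled_charlier_estimate_neg N X0.
  by exists C; split => // a nu x Xa; rewrite sub0r; exact: h.
(* The step evaluates at nu - 1 and nu - 2, hence down to -(N + 3); this is why N varies in the
   induction. *)
have [C [C0 h]] := IH (N + 2)%N.
(* In the new range m - 1 < nu <= m, so |nu - 1| <= m + 2 = Y - 1. *)
pose Y : R := m%:R + 3.
have m0 : 0 <= m%:R :> R by [].
have Y2 : 2 <= Y by rewrite /Y; lra.
(* The terms of the recurrence contribute 2X, 2Y and 2Y - 2 to the factor; the remaining 4 is
   slack. *)
pose C' := C * (2 * X + 4 * Y + 2).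
have C'0 : C <= C' by rewrite /C' ler_peMr ?(ltW C0)//; lra.
exists C'; split => [|a nu x Xa /andP[nu1 nu2] xX]; first exact: lt_le_trans C'0.
have a8 : 8 <= a by have := sqr_ge0 (4 * X); nra.
have a0 : 0 < a by lra.
set r := Num.sqrt a.
have r1 : 1 <= r by rewrite -sqrtr1 ler_wsqrtr//; lra.
have r0 : 0 < r by lra.
have N2 : N%:R + 3 = (N + 2).+1%:R :> R by rewrite -addnS natrD.
have [num|num] := leP nu (m%:R - 1).
  have [|s1 s2] := h a nu x Xa _ xX.
    by rewrite num andbT (le_trans _ nu1)// lerN2 ler_nat ltnS leq_addr.
  split; first exact: le_trans C'0.
  by rewrite (le_trans s2)// ler_wpM2r// invr_ge0 ltW.
have N0 : 0 <= N%:R :> R by [].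
rewrite -natr1 in nu2.
have [s1 s2] : `|scaled_charlier a (nu - 1) x| <= C /\
    `|scaled_charlier a (nu - 1) x - hermite (nu - 1) x| <= C / r.
  by apply: h => //; rewrite -N2; apply/andP; split; lra.
have [t1 t2] : `|scaled_charlier a (nu - 1 - 1) x| <= C /\
    `|scaled_charlier a (nu - 1 - 1) x - hermite (nu - 1 - 1) x| <= C / r.
  by apply: h => //; rewrite -N2; apply/andP; split; lra.
have := scaled_charlier_rec (nu - 1) x a0.
have := hermite_rec (nu - 1) x.
rewrite subrK => -> ->.
set y := nu - 1 in s1 s2 t1 t2 *.
have yY : `|y| <= Y - 1 by rewrite ler_norml /Y /y; apply/andP; split; lra.
set c := Num.sqrt (2 * a).
have c2 : c ^+ 2 = 2 * a by rewrite sqr_sqrtr// mulr_ge0// ltW.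
have rc : r <= c by rewrite ler_wsqrtr//; lra.
have c0 : 0 < c by lra.
have Xc : 4 * X + 4 <= c.
  rewrite -(@ger0_norm _ (4 * X + 4)); last lra.
  by rewrite -sqrtr_sqr ler_wsqrtr.
have [_ [theta /andP[th0 th1] nE]] := @charlier_index_spec _ a x X xX ltac:(rewrite -/c; lra) a0.
rewrite -/c in nE.
(* The exact deviation of the Charlier coefficient from 2x, from c/a = 2/c and y + a - n = x c + (y
   - theta). *)
pose d := 2 * (y - theta) / c.
have -> : c / a * (y + a - `|charlier_index a x|%N%:R) = 2 * x + d.
  have aE : a = c ^+ 2 / 2 by rewrite c2; field.
  have -> : y + a - `|charlier_index a x|%N%:R = y + x * c - theta by rewrite nE; ring.
  have -> : c / a = 2 / c by rewrite aE; field; rewrite gt_eqF.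
  by rewrite /d; field; rewrite gt_eqF.
have dY : `|d| <= 2 * Y / r.
  rewrite /d normrM normfV (gtr0_norm c0).
  apply: ler_pM => //; first by rewrite invr_ge0 ltW.
    rewrite normrM ger0_norm// ler_pM2l// (le_trans (ler_normB _ _))//.
    by rewrite (ger0_norm th0); lra.
  by rewrite lef_pV2 ?posrE.
have dY' : `|d| <= 2 * Y.
  by rewrite (le_trans dY)// ler_pdivrMr// ler_peMr//; lra.
move: s1 s2 t1 t2; set S1 := scaled_charlier a y x; set S2 := scaled_charlier a (y - 1) x.
set H1 := hermite y x; set H2 := hermite (y - 1) x => s1 s2 t1 t2.
have x2 : `|2 * x| <= 2 * X by rewrite normrM ger0_norm// ler_pM2l.
have y2 : `|2 * y| <= 2 * Y - 2 by rewrite normrM ger0_norm//; lra.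
split.
  have u1 : `|(2 * x + d) * S1| <= (2 * X + 2 * Y) * C.
    by rewrite normrM ler_pM// (le_trans (ler_normD _ _))// lerD.
  have u2 : `|2 * y * S2| <= (2 * Y - 2) * C by rewrite normrM ler_pM.
  rewrite (le_trans (ler_normB _ _))// /C'.
  rewrite (le_trans (lerD u1 u2))// -mulrDl mulrC ler_pM2l//; lra.
(* The term [d * S1] is O(1/sqrt a) because S1 is bounded; here the first conclusion of the
   induction hypothesis enters. *)
have -> : (2 * x + d) * S1 - 2 * y * S2 - (2 * x * H1 - 2 * y * H2) =
  2 * x * (S1 - H1) + d * S1 - 2 * y * (S2 - H2) by ring.
have u1 : `|2 * x * (S1 - H1)| <= 2 * X * (C / r) by rewrite normrM ler_pM.
have u2 : `|2 * y * (S2 - H2)| <= (2 * Y - 2) * (C / r) by rewrite normrM ler_pM.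
have u3 : `|d * S1| <= 2 * Y / r * C by rewrite normrM ler_pM.
rewrite (le_trans (ler_normB _ _))// (le_trans (lerD (ler_normD _ _) (lexx _)))//.
rewrite (le_trans (lerD (lerD u1 u3) u2))//.
have -> : C' / r = 2 * X * (C / r) + 2 * Y / r * C + (2 * Y - 2) * (C / r) + 4 * (C / r).
  by rewrite /C'; field; rewrite gt_eqF.
by rewrite lerDl mulr_ge0 ?divr_ge0 ?ltW.
Qed.

End Estimate.

(** * An explicit case with error of exact order 1/sqrt(a) *)

Section Sharpness.
Context {R : realType}.

Lemma hermite_1_0 : hermite 1 (0 : R) = 0.
Proof.
rewrite /hermite subrr mul0r.
have -> : (Gamma (0 : R))^-1 = 0 by rewrite invGamma_rec mul0r.
by rewrite mulr0 !mul0r subr0 mulr0.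
Qed.

(** At a half-integer the ceiling rounds up by exactly 1/2: n = a + 1/2, and the degree-n polynomial
    at 1 is 1 - n/a = -1/(2a), scaled by sqrt(2a). *)
Lemma scaled_charlier_1_0 (m : nat) :
  scaled_charlier (m%:R + 1 / 2 : R) 1 0 = - (Num.sqrt 2 / 2) / Num.sqrt (m%:R + 1 / 2).
Proof.
set a : R := m%:R + 1 / 2.
have a0 : 0 < a by rewrite /a ltr_wpDl//; lra.
have iE : charlier_index a 0 = m.+1%:Z.
  apply/eqP; rewrite /charlier_index mul0r subr0 ceil_eq intrB.
  by rewrite -[m.+1%:Z%:~R]/(m.+1%:R) -natr1 /a; apply/andP; split; lra.
rewrite /scaled_charlier iE/= -[1 / 2]/(1 * 2^-1) mul1r powR12_sqrt; last first.
  by rewrite mulr_ge0// ltW.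
have -> : charlier a m.+1 1 = 1 - m.+1%:R / a.
  rewrite charlierE big_ord_recl big_ord_recl/= big1 ?addr0.
    rewrite /falling big_ord0 big_ord1/= subr0 bin0 bin1 expr0 invr1 expr1.
    by rewrite !mulr1 invrN mulrN.
  move=> i _; rewrite /falling big_ord_recl big_ord_recl/= /bump/=.
  by rewrite subrr mul0r mulr0 mulr0.
have sE : Num.sqrt (2 * a) = Num.sqrt 2 * Num.sqrt a by rewrite sqrtrM.
have r0 : 0 < Num.sqrt a by rewrite sqrtr_gt0.
have aE : Num.sqrt a ^+ 2 = a by rewrite sqr_sqrtr// ltW.
have -> : 1 - m.+1%:R / a = - (1 / 2) / Num.sqrt a ^+ 2.
  by rewrite aE -natr1 /a; field; rewrite gt_eqF//; lra.
by rewrite sE; field; rewrite gt_eqF.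
Qed.

End Sharpness.

(** * Passage to bounded sets of nu and x *)

Section Uniformity.
Context {R : realType}.

Lemma bounded_set_nat (I : set R) : bounded_set I ->
  exists n : nat, forall x, I x -> `|x| <= n%:R.
Proof.
move=> [M [_ hM]]; exists (Num.truncn (M + 1)).+1 => x Ix.
apply: (hM _ _ x Ix); rewrite (lt_trans _ (truncnS_gt _))// ltrDl//.
Qed.

Lemma scaled_charlier_uniform (k : nat) (X : R) : 0 <= X ->
  exists C a0 : R, [/\ 0 < C, 0 < a0 &
    forall a nu x : R, a0 <= a -> `|nu| <= k%:R -> `|x| <= X ->
      0 <= charlier_index a x /\
      `|scaled_charlier a nu x - hermite nu x| <= C / Num.sqrt a].
Proof.
move=> X0; have [C [C0 h]] := scaled_charlier_estimate k.+1 k X0.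
exists C, ((4 * X + 4) ^+ 2 / 2); split => //.
  by rewrite divr_gt0// exprn_gt0//; lra.
move=> a nu x; rewrite ler_pdivrMr// [a * 2]mulrC => Xa.
rewrite ler_norml => /andP[nu1 nu2] xX.
have a0 : 0 < a by have := sqr_ge0 (4 * X); nra.
have Xc : 4 * X <= Num.sqrt (2 * a).
  apply: (@le_trans _ _ (4 * X + 4)); first lra.
  rewrite -(@ger0_norm _ (4 * X + 4)); last lra.
  by rewrite -sqrtr_sqr ler_wsqrtr.
have [i0 _] := charlier_index_spec xX Xc a0; split=> //.
have [|_ //] := h a nu x Xa _ xX.
by rewrite -!natr1; apply/andP; split; lra.
Qed.

End Uniformity.

Theorem theorem1 (R : realType) :
  (forall nu x : R,
     (fun a : R => scaled_charlier a nu x) =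
       cst (hermite nu x) +O_ (pinfty_nbhs R) (fun a : R => 1 / Num.sqrt a))
  /\
  (forall I J : set R,
     is_interval I -> bounded_set I -> is_interval J -> bounded_set J ->
     exists C a0 : R, [/\ 0 < C, 0 < a0 &
       forall a nu x : R, a0 <= a -> I nu -> J x ->
         0 <= charlier_index a x /\
         `|scaled_charlier a nu x - hermite nu x| <= C / Num.sqrt a])
  /\
  (exists nu x K : R, K != 0 /\
     forall A : R, exists a : R,
       [/\ A <= a, 0 < a, 0 <= charlier_index a x &
           scaled_charlier a nu x - hermite nu x = K / Num.sqrt a]).
Proof.
split; [|split].
- move=> nu x.
  have [k hk] : exists k : nat, `|nu| <= k%:R.
    by exists (Num.truncn `|nu|).+1; exact/ltW/truncnS_gt.
  have [C [a0 [C0 a00 h]]] := scaled_charlier_uniform k (normr_ge0 x).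
  apply/eqaddOP; exists C; split; [exact: num_real|move=> M /ltW CM].
  exists a0; split; [exact: num_real|move=> a /ltW a0a].
  have [_ ha] := h a nu x a0a hk (lexx _).
  rewrite /= (le_trans ha)// normrM normfV normr1 mul1r ger0_norm ?sqrtr_ge0//.
  by rewrite ler_wpM2r ?invr_ge0 ?sqrtr_ge0.
- move=> I J _ /bounded_set_nat[k hk] _ /bounded_set_nat[l hl].
  have [C [a0 [C0 a00 h]]] := scaled_charlier_uniform k (ler0n R l).
  exists C, a0; split => // a nu x a0a Inu Jx.
  by apply: h => //; [exact: hk|exact: hl].
- exists 1, 0, (- (Num.sqrt 2 / 2)); split.
    by rewrite oppr_eq0 mulf_neq0// gt_eqF// sqrtr_gt0.
  move=> A; pose m := (Num.truncn A).+1; exists (m%:R + 1 / 2).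
  have m0 : 0 <= m%:R :> R by [].
  split.
  + rewrite (@le_trans _ _ m%:R)//; last lra.
    exact/ltW/truncnS_gt.
  + lra.
  + by rewrite /charlier_index mul0r subr0 ceil_ge0; lra.
  + by rewrite hermite_1_0 subr0 scaled_charlier_1_0.
Qed.
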